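(* Let $\Omega\subset\mathbb{R}^n$, $n\ge2$, be a $C^1$ domain (bounded or unbounded), $f:\mathbb{R}\to\mathbb{R}$ a $C^1$ function, $\kappa$ a constant, and let $u\in C^3(\Omega)$ be a solution of $$\begin{cases}\mathrm{div}\left(\dfrac{\nabla u}{\sqrt{1+|\nabla u|^2}}\right)+f(u)=0 & \text{in }\Omega,\\ u>0 & \text{in }\Omega,\\ u=0 & \text{on }\partial\Omega,\\ \partial_\nu u=\kappa & \text{on }\partial\Omega,\end{cases}$$ with $u\le C$ and $|\nabla u|\le C$ for some constant $C$. Let $F\in C^2(\mathbb{R})$ be a nonpositive primitive of $f$ and let $$P(x)=F(u(x))-(1+|\nabla u(x)|^2)^{-\frac12}.$$ Then $$P(x)\le\max\left\{-1,\;F(0)-(1+\kappa^2)^{-\frac12}\right\}\quad\text{for all }x\in\Omega.$$ Moreover, if there exists a point $x_0\in\Omega$ such that $P(x_0)=\max\{-1,F(0)-(1+\kappa^2)^{-\frac12}\}$, then $P$ is constant, $\Omega$ is a half-space and $u$ is parallel.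
   Context: $\nu$ is the exterior unit normal on $\partial\Omega$. The solution $u$ is of class $C^1$ up to the boundary. The constant $\kappa$ is allowed to be $0$. A solution $u$ on a half-space $\{x\in\mathbb{R}^n: a\cdot(x-x_0)>0\}$ (with $x_0,a\in\mathbb{R}^n$) is called parallel if there is a function $g:[0,+\infty)\to\mathbb{R}$ with $u(x)=g(a\cdot(x-x_0))$ there.
   Formalization: The ''moreover'' part additionally assumes that ∂Ω is nonempty; otherwise it fails: for Ω=R^n, f=F=0, κ=0, u=1 one has P=-1=max{-1,-1}, but R^n is not a half-space. The inequality is stated without this assumption. *)

(* Defs.v *)
From HB Require Import structures.
From mathcomp Require Import all_boot all_order all_algebra.
From mathcomp Require Import all_classical all_reals all_analysis.

Set Implicit Arguments.
Unset Strict Implicit.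
Unset Printing Implicit Defensive.

Import Order.TTheory GRing.Theory Num.Theory.
Import numFieldNormedType.Exports.

Local Open Scope classical_set_scope.
Local Open Scope ring_scope.

(* Points and vectors of R^n are row vectors.  The library norm `|x| on 'rV_n
   is the sup norm: it is used only through the topology it induces, and
   lengths are measured with the Euclidean norm [enorm]. *)

Definition dot (R : realType) (n : nat) (v w : 'rV[R]_n) : R :=
  \sum_i v 0 i * w 0 i.

Definition enorm (R : realType) (n : nat) (v : 'rV[R]_n) : R :=
  Num.sqrt (dot v v).

Definition partial (R : realType) (n : nat) (i : 'I_n) (u : 'rV[R]_n -> R)
    (x : 'rV[R]_n) : R :=
  'D_(delta_mx 0 i : 'rV[R]_n) u x.

Definition grad (R : realType) (n : nat) (u : 'rV[R]_n -> R)
    (x : 'rV[R]_n) : 'rV[R]_n :=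
  \row_i partial i u x.

Definition divergence (R : realType) (n : nat) (V : 'rV[R]_n -> 'rV[R]_n)
    (x : 'rV[R]_n) : R :=
  \sum_i partial i (fun y => V y 0 i) x.

(* C^k on an open set Omega of R^n; values of u outside Omega are irrelevant. *)
Fixpoint Ck (R : realType) (n : nat) (k : nat) (Omega : set 'rV[R]_n)
    (u : 'rV[R]_n -> R) : Prop :=
  (forall x, Omega x -> {for x, continuous u}) /\
  match k with
  | 0 => True
  | k'.+1 => forall i : 'I_n,
      (forall x, Omega x -> derivable u x (delta_mx 0 i : 'rV[R]_n)) /\
      Ck k' Omega (partial i u)
  end.

Definition Ck_real (R : realType) (k : nat) (f : R -> R) : Prop :=
  (forall j, (j < k)%N -> forall t : R, derivable (derive1n j f) t 1) /\
  continuous (derive1n k f).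

Definition boundary (R : realType) (n : nat) (Omega : set 'rV[R]_n) :
    set 'rV[R]_n :=
  closure Omega `\` interior Omega.

(* Near p, Omega is the strict epigraph of phi after relabelling (i) and
   reorienting (b) the coordinate axes: (-1)^b x_i > phi(x'), where x' is x
   with its i-th coordinate removed. *)
Definition C1_chart (R : realType) (n : nat) (Omega : set 'rV[R]_n)
    (p : 'rV[R]_n) (i : 'I_n) (b : bool) (phi : 'rV[R]_n.-1 -> R) : Prop :=
  Ck 1 [set: 'rV[R]_n.-1] phi /\
  exists2 r : R, 0 < r & forall x : 'rV[R]_n, ball p r x ->
    (Omega x <-> phi (col' i x) < (-1) ^+ b * x 0 i).

Definition C1_domain (R : realType) (n : nat) (Omega : set 'rV[R]_n) : Prop :=
  [/\ open Omega, Omega !=set0, connected Omega &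
      forall p, boundary Omega p -> exists i b phi, C1_chart Omega p i b phi].

(* In a chart, Omega is locally {h < 0} with h(x) = phi(x') - (-1)^b x_i and
   grad h <> 0, so that the exterior unit normal is grad h / |grad h|. *)
Definition exterior_normal (R : realType) (n : nat) (Omega : set 'rV[R]_n)
    (p nu : 'rV[R]_n) : Prop :=
  exists i b phi, C1_chart Omega p i b phi /\
    let h := fun x : 'rV[R]_n => phi (col' i x) - (-1) ^+ b * x 0 i in
    nu = (enorm (grad h p))^-1 *: grad h p.

Definition C1_up_to_boundary (R : realType) (n : nat) (Omega : set 'rV[R]_n)
    (u : 'rV[R]_n -> R) : Prop :=
  [/\ Ck 1 Omega u,
      {within closure Omega, continuous u} &
      exists2 G : 'rV[R]_n -> 'rV[R]_n,
        {within closure Omega, continuous G} &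
        forall x, Omega x -> G x = grad u x].

(* The gradient at a boundary point is the limit from inside Omega, which
   exists when u is C^1 up to the boundary; [grad u p] itself would depend on
   the values of u outside the closure of Omega. *)
Definition boundary_grad (R : realType) (n : nat) (Omega : set 'rV[R]_n)
    (u : 'rV[R]_n -> R) (p : 'rV[R]_n) : 'rV[R]_n :=
  lim (grad u x @[x --> within Omega (nbhs p)]).

Definition normal_derivative (R : realType) (n : nat) (Omega : set 'rV[R]_n)
    (u : 'rV[R]_n -> R) (p nu : 'rV[R]_n) : R :=
  dot (boundary_grad Omega u p) nu.

Definition mean_curvature_op (R : realType) (n : nat) (u : 'rV[R]_n -> R) :
    'rV[R]_n -> R :=
  divergence (fun x => (Num.sqrt (1 + enorm (grad u x) ^+ 2))^-1 *: grad u x).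

Definition overdetermined_solution (R : realType) (n : nat)
    (Omega : set 'rV[R]_n) (f : R -> R) (kappa : R) (u : 'rV[R]_n -> R) :
    Prop :=
  [/\ forall x, Omega x -> mean_curvature_op u x + f (u x) = 0,
      forall x, Omega x -> 0 < u x,
      forall p, boundary Omega p -> u p = 0 &
      forall p nu, boundary Omega p -> exterior_normal Omega p nu ->
        normal_derivative Omega u p nu = kappa].

Definition P_function (R : realType) (n : nat) (F : R -> R) (u : 'rV[R]_n -> R)
    (x : 'rV[R]_n) : R :=
  F (u x) - (Num.sqrt (1 + enorm (grad u x) ^+ 2))^-1.

Definition half_space (R : realType) (n : nat) (x0 a : 'rV[R]_n) :
    set 'rV[R]_n :=
  [set x | 0 < dot a (x - x0)].

(* g is a total function, of which only the values on [0, +oo[ matter. *)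
Definition parallel (R : realType) (n : nat) (x0 a : 'rV[R]_n)
    (u : 'rV[R]_n -> R) : Prop :=
  exists g : R -> R, forall x, half_space x0 a x -> u x = g (dot a (x - x0)).

(* Main.v *)
Require Import Defs.
From HB Require Import structures.
From mathcomp Require Import all_boot all_order all_algebra.
From mathcomp Require Import all_classical all_reals all_analysis.
From mathcomp Require Import ring lra.

Set Implicit Arguments.
Unset Strict Implicit.
Unset Printing Implicit Defensive.

Import Order.TTheory GRing.Theory Num.Theory.
Import numFieldNormedType.Exports.

Local Open Scope classical_set_scope.
Local Open Scope ring_scope.

(** Write [g] for the gradient of [u], [q = |g|^2] and [m = (1 + q)^(-1/2)], so
    that [P = F u - m].

    The starting point is a differential inequality where [g] does not vanish:
    with the coefficients [a = I - m^2 g g^T] of the mean curvature operator and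
    the drift [b = (2 + q) f(u) m / q], the sum of [a_ij P_ij] and [b g . grad P]
    equals [m^3 |W|^2] plus a quadratic form in [grad P] that is nonnegative by
    Cauchy-Schwarz, where [W] is the Hessian of [u] compressed to the orthogonal
    complement of [g] ([P_function_identity], [gradient_terms_ge0]).
    Consequently [P + k] has no interior local maximum at such a point when [k]
    is a strict subsolution of this linear operator ([subsolution_at_max]). Both
    maximum principles come from this one statement with different choices
    of [k].

    For the upper bound, note that [F <= 0] bounds [q] from below wherever
    [P > -1 + eta], which makes the operator uniformly elliptic with bounded
    drift there. There [expR (l * u)] is a strict subsolution by a uniform
    margin for large [l]. Adding a small multiple of it to [P] leaves room for a
    small quadratic penalty [- d^2 |x - y|^2], which makes the maximum exist on an
    unbounded domain ([P_le_bound]). On the boundary the gradient is normal: [u] is positive inside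
    and zero there, so it cannot decrease in any entering direction; hence [P]
    equals [F 0 - (1 + kappa^2)^(-1/2)] ([boundary_gradient_norm]).

    Suppose that the bound [M] is attained. At such a point [g] does not vanish:
    otherwise [M = -1], and [P <= -1] together with the quadratic vanishing of [F]
    at [u x] gives [|g| <= K |u - u x|], so [u] is constant
    ([gradient_neq0_of_max]). Hopf's barrier then shows that the maximum set is
    open, hence all of [Omega] ([P_max_open], [P_constant]). With [P] constant the
    squares in the inequality vanish, so the Hessian is a multiple of [g g^T] and
    [g / |g|] is a constant [a] ([hess_of_constant_P], [direction_constant]).
    Then [u] does not decrease along any [w] with [w . a >= 0], so it never
    reaches the boundary value [0] in such a direction: [Omega] is stable under
    the half-space of these [w], which makes it a half-space, and [u] depends on
    the distance to its boundary only ([omega_half_space],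
    [parallel_solution]). *)

(** * Mean value estimates in coordinates *)

Lemma row_ballP (R : realType) n (x y : 'rV[R]_n) (e : R) :
  ball x e y <-> 0 < e /\ forall j, `|x 0 j - y 0 j| < e.
Proof.
split=> -[e0 xy]; split=> //.
  by move=> j; exact: xy.
by move=> i j; rewrite (ord1 i); exact: xy.
Qed.

Lemma mean_value01 (R : realType) (phi dphi : R -> R) :
  (forall s : R, 0 <= s <= 1 -> is_derive s 1 phi (dphi s)) ->
  exists2 s : R, 0 <= s <= 1 & phi 1 - phi 0 = dphi s.
Proof.
move=> d; have [||s sI ->] := @MVT_segment R phi dphi 0 1 ler01.
- by move=> x; rewrite in_itv/= => /andP[x0 x1]; apply: d; rewrite !ltW.
- apply: derivable_within_continuous => x; rewrite in_itv/= => xI.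
  by have [] := d _ xI.
- by exists s; [move: sI; rewrite in_itv/=|rewrite subr0 mulr1].
Qed.

Lemma is_derive_line (R : realType) n (g : 'rV[R]_n -> R) (x v : 'rV[R]_n) t :
  derivable g (x + t *: v) v ->
  is_derive t 1 (fun s : R => g (x + s *: v)) ('D_v g (x + t *: v)).
Proof.
have E : (fun h : R => h^-1 *: (g (x + (h *: 1 + t) *: v) - g (x + t *: v)))
    = (fun h => h^-1 *: (g (h *: v + (x + t *: v)) - g (x + t *: v))).
  apply/funext => h; congr (_ *: (g _ - _)).
  by rewrite scalerDl [h *: 1]mulr1 addrCA.
move=> dg; split; first by rewrite /derivable /= E.
by rewrite /derive /= E.
Qed.

(** The points [hybrid y z m], for [m] from [0] to [n], go from [y] to [z] by
    changing one coordinate at a time. *)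
Definition hybrid (R : realType) n (y z : 'rV[R]_n) (m : nat) : 'rV[R]_n :=
  \row_j (if (j < m)%N then z 0 j else y 0 j).

Lemma hybridS (R : realType) n (y z : 'rV[R]_n) (i : 'I_n) :
  hybrid y z i.+1 = hybrid y z i + (z 0 i - y 0 i) *: delta_mx 0 i.
Proof.
apply/rowP => j; rewrite !mxE eqxx/= ltnS leq_eqVlt.
case: (ltngtP j i) => [ji|ji|/val_inj->].
- by rewrite orbT -val_eqE/= (ltn_eqF ji) mulr0 addr0.
- by rewrite -val_eqE/= (gtn_eqF ji)/= mulr0 addr0.
- by rewrite !eqxx /= mulr1 addrC subrK.
Qed.

(** A ball of the sup norm is a box, so changing single coordinates does not
    lead out of it. *)
Lemma hybrid_ball (R : realType) n (x y z : 'rV[R]_n) e (i : 'I_n) s :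
  ball x e y -> ball x e z -> 0 <= s <= 1 ->
  ball x e (hybrid y z i + (s * (z 0 i - y 0 i)) *: delta_mx 0 i).
Proof.
move=> /row_ballP[e0 xy] /row_ballP[_ xz] /andP[s0 s1].
apply/row_ballP; split=> // j; rewrite !mxE eqxx/=.
have [ji|ji|/val_inj->] := ltngtP j i.
- by rewrite -val_eqE/= (ltn_eqF ji) mulr0 addr0.
- by rewrite -val_eqE/= (gtn_eqF ji)/= mulr0 addr0.
- rewrite !eqxx mulr1; move: (xy i) (xz i); rewrite !ltr_norml.
  by case: (leP (y 0 i) (z 0 i)) => yz /andP[? ?] /andP[? ?];
    apply/andP; split; nra.
Qed.

(** Continuity of the partial derivatives gives differentiability: the
    increment telescopes along the hybrid points, and each step is a
    one-dimensional mean value. *)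
Lemma increment_ball (R : realType) n (g : 'rV[R]_n -> R) (c : 'I_n -> R)
    (x y z : 'rV[R]_n) (r e : R) :
  (forall w i, ball x r w -> derivable g w (delta_mx 0 i)) ->
  (forall w i, ball x r w -> `|partial i g w - c i| <= e) ->
  ball x r y -> ball x r z ->
  `|g z - g y - \sum_i c i * (z 0 i - y 0 i)| <= e * \sum_i `|z 0 i - y 0 i|.
Proof.
move=> dg ge xy xz.
have gz : g z = g (hybrid y z n).
  by congr g; apply/rowP => j; rewrite mxE ltn_ord.
have gy : g y = g (hybrid y z 0) by congr g; apply/rowP => j; rewrite mxE.
have -> : g z - g y = \sum_(i < n) (g (hybrid y z i.+1) - g (hybrid y z i)).
  by rewrite gz gy -(big_mkord predT
    (fun i => g (hybrid y z i.+1) - g (hybrid y z i))) telescope_sumr.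
rewrite -sumrB mulr_sumr; apply: le_trans (ler_norm_sum _ _ _) _.
apply: ler_sum => i _; set d := z 0 i - y 0 i.
pose phi s := g (hybrid y z i + s *: (d *: delta_mx 0 i)).
have [s sI phiE] : exists2 s : R, 0 <= s <= 1 & phi 1 - phi 0 =
    d * partial i g (hybrid y z i + (s * d) *: delta_mx 0 i).
  apply: mean_value01 => s sI.
  have E : phi = (fun t => g (hybrid y z i + t *: delta_mx 0 i)) \o
      (fun t => t * d).
    by apply/funext => t; rewrite /phi /= scalerA.
  rewrite E mulrC.
  have := is_derive_line (dg _ i (hybrid_ball i xy xz sI)); rewrite -/d => h.
  have h2 : is_derive s 1 (fun t : R => t * d) d.
    rewrite [X in is_derive _ _ X _](_ : _ = d *: id); last first.
      by apply/funext => t /=; rewrite mulrC.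
    by apply: is_derive_eq; rewrite scaler1.
  exact: is_derive1_comp.
have -> : g (hybrid y z i.+1) - g (hybrid y z i) = phi 1 - phi 0.
  by rewrite hybridS /phi scale1r scale0r addr0.
rewrite phiE [c i * _]mulrC -mulrBr normrM mulrC ler_wpM2r//.
exact/ge/hybrid_ball.
Qed.

(** * Functions with continuous partial derivatives *)

Lemma is_derive_expansion (R : realType) (phi : R -> R) (t d : R) :
  (forall e : R, 0 < e -> exists2 r : R, 0 < r &
    forall h : R, `|h| < r -> `|phi (t + h) - phi t - h * d| <= e * `|h|) ->
  is_derive t 1 phi d.
Proof.
move=> H.
have L : (fun h : R => h^-1 *: (phi (h *: (1 : R) + t) - phi t)) @ 0^' --> d.
  apply/cvgrPdist_le => e e0; have [r r0 hr] := H _ e0.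
  near=> h.
  have h0 : h != 0 by near: h; exact: nbhs_dnbhs_neq.
  rewrite distrC [h *: 1]mulr1 [h + t]addrC.
  have -> : h^-1 *: (phi (t + h) - phi t) - d
      = h^-1 * (phi (t + h) - phi t - h * d).
    by rewrite [_ *: _](erefl (h^-1 * _)); field.
  rewrite normrM normfV mulrC ler_pdivrMr ?normr_gt0//; apply: hr.
  by near: h; apply: dnbhs0_lt.
split; first by apply/cvg_ex; exists d.
exact: cvg_lim L.
Unshelve. all: by end_near. Qed.

Lemma is_derive_expansion_inv (R : realType) (phi : R -> R) (t d : R) :
  is_derive t 1 phi d ->
  forall e : R, 0 < e -> exists2 r : R, 0 < r &
    forall h : R, `|h| < r -> `|phi (t + h) - phi t - h * d| <= e * `|h|.
Proof.
move=> [dphi dE] e e0.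
have L : (fun h : R => h^-1 *: (phi (h *: (1 : R) + t) - phi t)) @ 0^' --> d.
  by rewrite -dE.
move/cvgrPdist_le : L => /(_ _ e0) /nbhs_ballP[r /= r0 hr].
exists r => // h hr'; have [->|h0] := eqVneq h 0.
  by rewrite addr0 subrr mul0r subrr normr0 mulr0.
have := hr h; rewrite /ball/= sub0r normrN => /(_ hr' h0).
rewrite distrC [h *: 1]mulr1 [h + t]addrC.
have -> : h^-1 *: (phi (t + h) - phi t) - d
      = h^-1 * (phi (t + h) - phi t - h * d).
  by rewrite [_ *: _](erefl (h^-1 * _)); field.
by rewrite normrM normfV mulrC ler_pdivrMr ?normr_gt0.
Qed.

(** If [d] were positive, [psi] would be positive to the right of [0] and
    [phi] would exceed its maximum. *)
Lemma second_derivative_test (R : realType) (phi psi : R -> R) (d r : R) :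
  0 < r ->
  (forall t : R, `|t| < r -> is_derive t 1 phi (psi t)) ->
  is_derive (0 : R) 1 psi d ->
  (forall t : R, `|t| < r -> phi t <= phi 0) ->
  psi 0 = 0 /\ d <= 0.
Proof.
move=> r0 dphi dpsi max0.
have itvP_ (t : R) : (t \in `](- r), r[) = (`|t| < r).
  by rewrite in_itv/= ltr_norml.
have p0 : psi 0 = 0.
  have d0 : is_derive (0 : R) 1 phi (psi 0) by apply: dphi; rewrite normr0.
  have := @derive1_at_max R phi (- r) r 0.
  move=> /(_ _ _ _ _) h; rewrite -(@derive_val _ _ _ _ _ _ _ d0).
  have : is_derive (0 : R) 1 phi 0.
    apply: h; first by rewrite (le_trans _ (ltW r0))// oppr_le0 ltW.
    - by move=> t; rewrite itvP_ => /dphi[].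
    - by rewrite itvP_ normr0.
    - by move=> t; rewrite itvP_ => /max0.
  by move=> h2; exact: derive_val.
split=> //; rewrite leNgt; apply/negP => d0.
have d20 : 0 < d / 2 by rewrite divr_gt0.
have [s s0 hs] := is_derive_expansion_inv dpsi d20.
pose t := Num.min r s / 2.
have m0 : 0 < Num.min r s by rewrite lt_min r0 s0.
have t0 : 0 < t by rewrite divr_gt0.
have tm : t < Num.min r s by rewrite /t; lra.
have [tr ts] : t < r /\ t < s by move: tm; rewrite lt_min => /andP[].
have [||c] := @MVT R phi psi 0 t t0.
- move=> x; rewrite in_itv/= => /andP[x0 xt].
  by apply: dphi; rewrite gtr0_norm// (lt_trans xt).
- apply: derivable_within_continuous => x; rewrite in_itv/= => /andP[x0 xt].
  have xr : `|x| < r by rewrite ger0_norm// (le_lt_trans xt).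
  by have [] := dphi _ xr.
rewrite in_itv/= subr0 => /andP[c0 ct] E.
have := max0 t; rewrite gtr0_norm// => /(_ tr).
rewrite -subr_le0 E; apply/negP; rewrite -ltNge; apply: mulr_gt0 => //.
have := hs c; rewrite (gtr0_norm c0) add0r p0 subr0.
move=> /(_ (lt_trans ct ts)); rewrite ler_norml => /andP[+ _].
nra.
Qed.

Section Ck_calculus.
Context (R : realType) (n : nat) (Omega : set 'rV[R]_n).
Hypothesis oO : open Omega.
Implicit Types (g : 'rV[R]_n -> R) (x y z w : 'rV[R]_n).

Lemma Ck_continuous k g x : Ck k Omega g -> Omega x -> {for x, continuous g}.
Proof. by case: k => [|k] /= [h _]; exact: h. Qed.

Lemma Ck_partial k g i : Ck k.+1 Omega g -> Ck k Omega (partial i g).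
Proof. by move=> [_ /(_ i)[]]. Qed.

Lemma Ck_derivable k g i x : Ck k.+1 Omega g -> Omega x ->
  derivable g x (delta_mx 0 i).
Proof. by move=> [_ /(_ i)[+ _]]; exact. Qed.

Lemma CkW k g : Ck k.+1 Omega g -> Ck k Omega g.
Proof.
elim: k g => [|k IH] g; first by case.
move=> [c h]; split=> // i; have [d ck] := h i; split=> //.
exact: IH.
Qed.

Lemma open_ball_sub x : Omega x ->
  exists2 r : R, 0 < r & ball x r `<=` Omega.
Proof.
move=> Ox; have /nbhs_ballP[r /= r0 h] := open_nbhs_nbhs (conj oO Ox).
by exists r.
Qed.

Lemma C1_increment g x (e : R) : Ck 1 Omega g -> Omega x -> 0 < e ->
  exists2 r : R, 0 < r & ball x r `<=` Omega /\
    forall y z, ball x r y -> ball x r z ->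
      `|g z - g y - dot (z - y) (grad g x)| <= e * \sum_i `|z 0 i - y 0 i|.
Proof.
move=> Cg Ox e0.
have : \forall y \near x, Omega y /\
    forall i, `|partial i g y - partial i g x| <= e.
  apply: filterI; first exact: open_nbhs_nbhs.
  have /(filter_forall) : forall i : 'I_n, \forall y \near x,
      `|partial i g y - partial i g x| <= e.
    move=> i; have := Ck_continuous (Ck_partial i Cg) Ox.
    move=> /cvgrPdist_le /(_ _ e0); apply: filterS => y.
    by rewrite distrC.
  by apply.
move=> /nbhs_ballP[r /= r0 hr]; exists r => //; split.
  by move=> y /hr[].
move=> y z xy xz.
have -> : dot (z - y) (grad g x) = \sum_i partial i g x * (z 0 i - y 0 i).
  by apply: eq_bigr => i _; rewrite !mxE mulrC.
apply: increment_ball xy xz => w i xw.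
  by apply: (Ck_derivable Cg); case: (hr _ xw).
by case: (hr _ xw).
Qed.

Lemma C1_is_derive_line g x w (t : R) : Ck 1 Omega g -> Omega (x + t *: w) ->
  is_derive t 1 (fun s : R => g (x + s *: w)) (dot w (grad g (x + t *: w))).
Proof.
move=> Cg Ox; apply: is_derive_expansion => e e0.
pose N := 1 + \sum_i `|w 0 i|.
have N0 : 0 < N by rewrite ltr_wpDr// sumr_ge0.
have eN : 0 < e / N by rewrite divr_gt0.
have [r r0 [_ hr]] := C1_increment Cg Ox eN.
exists (r / N); first by rewrite divr_gt0.
move=> h hrN.
have hwb : ball (x + t *: w) r (x + (t + h) *: w).
  apply/row_ballP; split=> // j; rewrite !mxE.
  have -> : x 0 j + t * w 0 j - (x 0 j + (t + h) * w 0 j) = - (h * w 0 j).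
    by ring.
  rewrite normrN normrM; move: hrN; rewrite ltr_pdivlMr//; apply: le_lt_trans.
  rewrite ler_wpM2l// /N (bigD1 j)//= addrCA lerDl addr_ge0// sumr_ge0//.
have := hr _ _ (ballxx _ r0) hwb.
have -> : x + (t + h) *: w - (x + t *: w) = h *: w.
  by apply/rowP => j; rewrite !mxE; ring.
have -> : dot (h *: w) (grad g (x + t *: w)) = h * dot w (grad g (x + t *: w)).
  by rewrite /dot mulr_sumr; apply: eq_bigr => i _; rewrite !mxE mulrA.
move=> /le_trans; apply.
under eq_bigr => i _.
  have -> : (x + (t + h) *: w) 0 i - (x + t *: w) 0 i = h * w 0 i.
    by rewrite !mxE; ring.
  rewrite normrM; over.
rewrite -mulr_sumr [leLHS](_ : _ = e * `|h| * ((\sum_i `|w 0 i|) / N)).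
  by rewrite ler_piMr ?mulr_ge0// ?ltW// ltr_pdivrMr// mul1r /N ltrDr.
by field; rewrite gt_eqF.
Qed.

Lemma second_difference g x (i j : 'I_n) (e : R) :
  Ck 2 Omega g -> Omega x -> 0 < e ->
  exists2 r : R, 0 < r & forall h : R, 0 < h < r ->
    `|g (x + h *: delta_mx 0 i + h *: delta_mx 0 j) - g (x + h *: delta_mx 0 i)
      - g (x + h *: delta_mx 0 j) + g x - h ^+ 2 * partial j (partial i g) x|
    <= e * h ^+ 2.
Proof.
move=> Cg Ox e0.
have [r r0 [rO hr]] := C1_increment (Ck_partial i Cg) Ox e0.
exists (r / 2); first by rewrite divr_gt0.
move=> h /andP[h0 hr2].
set ei := delta_mx 0 i; set ej := delta_mx 0 j.
have inb (s : R) (b : bool) : 0 <= s <= 1 ->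
    ball x r (x + h *: ej *+ b + s *: (h *: ei)).
  move=> /andP[s0 s1]; apply/row_ballP; split=> // k.
  rewrite !mxE mulmxnE !mxE !eqxx/=.
  case: b => /=; case: (k == i) => /=; case: (k == j) => /=;
    rewrite ?mulr1n ?mulr0n ?mulr0 ?mulr1 ?addr0 ?subrr ?normr0 // ltr_norml;
    apply/andP; split; nra.
pose k (s : R) := g (x + h *: ej *+ true + s *: (h *: ei))
  - g (x + h *: ej *+ false + s *: (h *: ei)).
have dotei y : dot (h *: ei) (grad g y) = h * partial i g y.
  rewrite /dot (bigD1 i)//= big1 ?addr0; first by rewrite !mxE !eqxx mulr1.
  by move=> l li; rewrite !mxE (negbTE li) mulr0 mul0r.
have [s sI] : exists2 s : R, 0 <= s <= 1 & k 1 - k 0 =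
    h * partial i g (x + h *: ej *+ true + s *: (h *: ei))
    - h * partial i g (x + h *: ej *+ false + s *: (h *: ei)).
  apply: mean_value01 => s sI.
  by rewrite -!dotei; apply: is_deriveB; apply: (C1_is_derive_line (CkW Cg));
    apply: rO; exact: inb.
rewrite /k !mulr1n !mulr0n !scale1r !scale0r !addr0 => E.
have -> : g (x + h *: ei + h *: ej) - g (x + h *: ei) - g (x + h *: ej) + g x
    = h * (partial i g (x + h *: ej + s *: (h *: ei))
           - partial i g (x + s *: (h *: ei))).
  rewrite mulrBr -E [x + h *: ei + _]addrAC; ring.
have := hr _ _ (inb s false sI) (inb s true sI).
rewrite mulr1n mulr0n addr0.
have D : x + h *: ej + s *: (h *: ei) - (x + s *: (h *: ei)) = h *: ej.
  by apply/rowP => l; rewrite !mxE; ring.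
rewrite D.
have -> : dot (h *: ej) (grad (partial i g) x) = h * partial j (partial i g) x.
  rewrite /dot (bigD1 j)//= big1 ?addr0; first by rewrite !mxE !eqxx mulr1.
  by move=> l li; rewrite !mxE (negbTE li) mulr0 mul0r.
rewrite (eq_bigr (fun l => `|(h *: ej) 0 l|)); last first.
  by move=> l _; rewrite -[in RHS]D !mxE.
rewrite (bigD1 j)//= big1 ?addr0; last first.
  by move=> l li; rewrite !mxE (negbTE li) mulr0 normr0.
rewrite !mxE !eqxx mulr1 (gtr0_norm h0) => H.
set A := partial i g _ in H *; set B := partial i g _ in H *.
rewrite expr2 -mulrA -mulrBr normrM (gtr0_norm h0) mulrCA ler_wpM2l//.
exact: ltW.
Qed.

Lemma close_of_second_differences (h e X Y Z V p q : R) : 0 < h ->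
  `|X - Y - Z + V - h ^+ 2 * p| <= e / 2 * h ^+ 2 ->
  `|X - Z - Y + V - h ^+ 2 * q| <= e / 2 * h ^+ 2 -> `|q - p| <= e.
Proof.
move=> h0; have : 0 < h ^+ 2 by rewrite exprn_gt0.
move: (h ^+ 2) => {h0}h h0; rewrite !ler_norml => /andP[a1 a2] /andP[b1 b2].
by apply/andP; split; rewrite -(ler_pM2l h0); lra.
Qed.

(** Schwarz: both iterated derivatives are the limit of the same second
    difference, which is symmetric in the two directions. *)
Lemma partialC g x (i j : 'I_n) : Ck 2 Omega g -> Omega x ->
  partial i (partial j g) x = partial j (partial i g) x.
Proof.
move=> Cg Ox; apply/eqP; rewrite -subr_eq0 -normr_le0.
apply/ler_addgt0Pr => e e0; rewrite add0r.
have e2 : 0 < e / 2 by rewrite divr_gt0.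
have [r r0 hr] := second_difference i j Cg Ox e2.
have [s s0 hs] := second_difference j i Cg Ox e2.
pose h := Num.min r s / 2.
have m0 : 0 < Num.min r s by rewrite lt_min r0 s0.
have h0 : 0 < h by rewrite divr_gt0.
have : h < Num.min r s by rewrite /h; lra.
rewrite lt_min => /andP[hr' hs'].
have := hr h; have := hs h; rewrite h0 hr' hs' => /(_ isT) + /(_ isT).
rewrite [x + h *: delta_mx 0 j + _]addrAC => H1 H2.
exact: (close_of_second_differences h0 H2 H1).
Qed.

End Ck_calculus.

(** * Second-order derivatives along lines *)

Lemma is_derive_sumE (R : realType) n (h : 'I_n -> R -> R) (d : 'I_n -> R)
    (t : R) :
  (forall i, is_derive t 1 (h i) (d i)) ->
  is_derive t 1 (fun s => \sum_i h i s) (\sum_i d i).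
Proof.
move=> hd; rewrite (_ : (fun _ => _) = \sum_i h i); last first.
  by apply/funext => s; rewrite fct_sumE.
exact: is_derive_sum.
Qed.

Lemma is_derive_mul (R : realType) (h k : R -> R) (t a b : R) :
  is_derive t 1 h a -> is_derive t 1 k b ->
  is_derive t 1 (fun s => h s * k s) (a * k t + h t * b).
Proof.
move=> dh dk; apply: is_derive_eq.
by rewrite addrC mulrC.
Qed.

Lemma is_derive_affine (R : realType) (a b t : R) :
  is_derive t 1 (fun s => a + s * b) b.
Proof.
have -> : (fun s => a + s * b) = cst a + b *: id.
  by apply/funext => s /=; rewrite !fctE mulrC.
by apply: is_derive_eq; rewrite add0r [_ *: _]mulr1.
Qed.

Lemma is_derive_continuous (R : realType) (h : R -> R) (t a : R) :
  is_derive t 1 h a -> {for t, continuous h}.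
Proof.
by case=> dh _; apply/differentiable_continuous/derivable1_diffP.
Qed.

Section jets.
Context (R : realType) (n : nat).
Implicit Types (k l : 'rV[R]_n -> R) (z w : 'rV[R]_n) (a b c d : R).

(** First and second derivative [a], [b] of [k] at [z] along the line of
    direction [w]. All second-order information is handled in this form, so
    that only one-variable calculus is needed to differentiate [P]. *)
Definition jet2 k z w a b := exists2 psi : R -> R,
  (\forall t \near (0 : R),
    is_derive (t : R) 1 (fun s : R => k (z + s *: w)) (psi t))
  & psi 0 = a /\ is_derive (0 : R) 1 psi b.

Lemma jet2_eq k z w a b a' b' : jet2 k z w a b -> a = a' -> b = b' ->
  jet2 k z w a' b'.
Proof. by move=> + <- <-. Qed.

Lemma jet2D k l z w a b c d : jet2 k z w a b -> jet2 l z w c d ->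
  jet2 (fun x => k x + l x) z w (a + c) (b + d).
Proof.
move=> [p hp [<- dp]] [p' hp' [<- dp']].
exists (fun t => p t + p' t); last by split=> //; exact: is_deriveD.
by apply: filterS2 hp hp' => t h h'; exact: is_deriveD.
Qed.

Lemma jet2Z k z w a b c : jet2 k z w a b ->
  jet2 (fun x => c * k x) z w (c * a) (c * b).
Proof.
move=> [p hp [<- dp]].
exists (fun t => c * p t); last by split=> //; exact: is_deriveZ.
by apply: filterS hp => t h; exact: is_deriveZ.
Qed.

Lemma jet2_sum m (k : 'I_m -> 'rV[R]_n -> R) z w (a b : 'I_m -> R) :
  (forall i, jet2 (k i) z w (a i) (b i)) ->
  jet2 (fun x => \sum_i k i x) z w (\sum_i a i) (\sum_i b i).
Proof.
move=> H; pose p i := projT1 (cid2 (H i)).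
have pP i : (\forall t \near (0 : R),
    is_derive (t : R) 1 (fun s : R => k i (z + s *: w)) (p i t)) /\
    p i 0 = a i /\ is_derive (0 : R) 1 (p i) (b i).
  by rewrite /p; case: (cid2 _).
exists (fun t => \sum_i p i t); last first.
  split; first by apply: eq_bigr => i _; have [_ []] := pP i.
  by apply: is_derive_sumE => i; have [_ []] := pP i.
suff : \forall t \near (0 : R), forall i,
    is_derive (t : R) 1 (fun s : R => k i (z + s *: w)) (p i t).
  by apply: filterS => t ht; exact: is_derive_sumE.
have h i := (pP i).1.
exact: (@filter_forall R _ _ _ (nbhs_filter (0 : R)) h).
Qed.

Lemma jet2_comp (phi dphi : R -> R) k z w a b c :
  (\forall s \near k z, is_derive (s : R) 1 phi (dphi s)) ->
  is_derive (k z) 1 dphi c ->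
  jet2 k z w a b ->
  jet2 (phi \o k) z w (dphi (k z) * a) (c * a ^+ 2 + dphi (k z) * b).
Proof.
move=> hphi dd [p hp [<- dp]].
have E0 : k (z + 0 *: w) = k z by rewrite scale0r addr0.
have kc : (fun s : R => k (z + s *: w)) @ (0 : R) --> k z.
  rewrite -E0; apply: (is_derive_continuous (nbhs_singleton hp)).
exists (fun t => dphi (k (z + t *: w)) * p t); last first.
  split; first by rewrite E0.
  have d1 : is_derive (0 : R) 1 (dphi \o (fun t : R => k (z + t *: w)))
      (c * p 0).
    by apply: is_derive1_comp; [rewrite E0|exact: nbhs_singleton hp].
  have := is_derive_mul d1 dp; rewrite /= E0.
  by move=> h; apply: is_derive_eq; rewrite expr2 mulrA.
have hphi' : \forall t \near (0 : R),
  is_derive (k (z + t *: w)) 1 phi (dphi (k (z + t *: w))) := kc _ hphi.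
by apply: filterS2 hphi' hp => t h h'; exact: (@is_derive1_comp _ phi).
Qed.

Lemma line_continuous z w : continuous (fun t : R => z + t *: w).
Proof.
by move=> t; apply: cvgD; [exact: cvg_cst|apply: cvgZr_tmp; exact: cvg_id].
Qed.

Lemma line_cvg0 z w : (fun t : R => z + t *: w) @ (0 : R) --> z.
Proof.
have := @line_continuous z w 0.
by rewrite /continuous_at (_ : z + 0 *: w = z) // scale0r addr0.
Qed.

Lemma jet2_max k z w a b : jet2 k z w a b ->
  (\forall x \near z, k x <= k z) -> a = 0 /\ b <= 0.
Proof.
move=> [p hp [<- dp]] hm.
have {}hm : \forall t \near (0 : R), k (z + t *: w) <= k z := line_cvg0 w hm.
have : \forall t \near (0 : R),
    is_derive (t : R) 1 (fun s : R => k (z + s *: w)) (p t) /\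
    k (z + t *: w) <= k z by exact: filterI.
move=> /nbhs_ballP[r /= r0 hr].
have H t : `|t| < r -> ball (0 : R) r t by rewrite /ball/= sub0r normrN.
apply: (@second_derivative_test _ (fun t : R => k (z + t *: w)) p b r r0) => //.
  by move=> t /H/hr[].
by move=> t /H/hr[_] /=; rewrite scale0r addr0.
Qed.

Lemma jet2_sqdist y z w :
  jet2 (fun x => dot (x - y) (x - y)) z w (2 * dot w (z - y)) (2 * dot w w).
Proof.
have d (t : R) : is_derive t 1
    (fun s : R => dot (z + s *: w - y) (z + s *: w - y))
    (2 * dot w (z - y) + t * (2 * dot w w)).
  have -> : (fun s : R => dot (z + s *: w - y) (z + s *: w - y)) =
     (fun s => \sum_i (z 0 i - y 0 i + s * w 0 i) ^+ 2).
    by apply/funext => s; apply: eq_bigr => i _; rewrite !mxE; ring.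
  have -> : 2 * dot w (z - y) + t * (2 * dot w w) =
      \sum_i (2 * w 0 i * (z 0 i - y 0 i + t * w 0 i)).
    rewrite /dot !mulr_sumr -big_split/=; apply: eq_bigr => i _.
    by rewrite !mxE; ring.
  apply: is_derive_sumE => i.
  have h := is_derive_affine (z 0 i - y 0 i) (w 0 i) t.
  have -> : (fun s => (z 0 i - y 0 i + s * w 0 i) ^+ 2) =
      (fun s => (z 0 i - y 0 i + s * w 0 i) * (z 0 i - y 0 i + s * w 0 i)).
    by apply/funext => s; rewrite expr2.
  have := is_derive_mul h h; move=> ?; apply: is_derive_eq; ring.
exists (fun t => 2 * dot w (z - y) + t * (2 * dot w w)).
  by apply: filterE => t; exact: d.
split; first by rewrite mul0r addr0.
exact: is_derive_affine.
Qed.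

Variable Omega : set 'rV[R]_n.
Hypothesis oO : open Omega.

Lemma near_line z w : Omega z -> \forall t \near (0 : R), Omega (z + t *: w).
Proof.
move=> Oz; have /(line_cvg0 w) : nbhs z Omega by exact: open_nbhs_nbhs.
by [].
Qed.

Lemma jet2_C2 k z w : Ck 2 Omega k -> Omega z ->
  jet2 k z w (dot w (grad k z))
    (\sum_i w 0 i * dot w (grad (partial i k) z)).
Proof.
move=> Ck2 Oz; exists (fun t => dot w (grad k (z + t *: w))).
  apply: filterS (near_line w Oz) => t.
  exact: (C1_is_derive_line oO (CkW Ck2)).
rewrite scale0r addr0; split=> //.
apply: is_derive_sumE => i.
have -> : (fun s : R => w 0 i * grad k (z + s *: w) 0 i) =
   (fun s : R => w 0 i *: partial i k (z + s *: w)).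
  by apply/funext => s; rewrite mxE.
apply: is_deriveZ; rewrite -[X in grad _ X]addr0 -(scale0r w).
by apply: (C1_is_derive_line oO (Ck_partial i Ck2)); rewrite scale0r addr0.
Qed.

End jets.

(** * The algebraic identity for the P-function *)

Section frobenius.
Context (R : realType) (n : nat).
Implicit Types (a b c d w : 'rV[R]_n) (A B D : 'M[R]_n).

Lemma dotC a b : dot a b = dot b a.
Proof. by apply: eq_bigr => i _; rewrite mulrC. Qed.

Lemma dotDl a b c : dot (a + b) c = dot a c + dot b c.
Proof. by rewrite -big_split/=; apply: eq_bigr => i _; rewrite !mxE mulrDl. Qed.

Lemma dotZl (s : R) a b : dot (s *: a) b = s * dot a b.
Proof. by rewrite mulr_sumr; apply: eq_bigr => i _; rewrite !mxE mulrA. Qed.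

Lemma dotDr a b c : dot c (a + b) = dot c a + dot c b.
Proof. by rewrite dotC dotDl !(dotC c). Qed.

Lemma dotZr (s : R) a b : dot b (s *: a) = s * dot b a.
Proof. by rewrite dotC dotZl dotC. Qed.

Lemma dotNl a b : dot (- a) b = - dot a b.
Proof. by rewrite -scaleN1r dotZl mulN1r. Qed.

Lemma dotNr a b : dot a (- b) = - dot a b.
Proof. by rewrite dotC dotNl dotC. Qed.

Lemma dot0l a : dot 0 a = 0.
Proof. by rewrite /dot big1// => i _; rewrite mxE mul0r. Qed.

Lemma dot0r a : dot a 0 = 0.
Proof. by rewrite dotC dot0l. Qed.

Lemma dot_ge0 a : 0 <= dot a a.
Proof. by apply: sumr_ge0 => i _; rewrite -expr2 sqr_ge0. Qed.

Lemma dot_eq0 a : (dot a a == 0) = (a == 0).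
Proof.
apply/idP/eqP => [|->]; last first.
  by rewrite dot0l.
rewrite psumr_eq0; last by move=> i _; rewrite -expr2 sqr_ge0.
move=> /allP h; apply/rowP => i; rewrite mxE; apply/eqP.
by rewrite -sqrf_eq0 expr2; apply: h; rewrite mem_index_enum.
Qed.

Lemma dot_gt0 a : (0 < dot a a) = (a != 0).
Proof. by rewrite lt0r dot_ge0 andbT dot_eq0. Qed.

Lemma cauchy_schwarz a b : dot a b ^+ 2 <= dot a a * dot b b.
Proof.
have [->|a0] := eqVneq a 0.
  by rewrite !dot0l mul0r expr0n.
have a0' : 0 < dot a a by rewrite dot_gt0.
have := dot_ge0 (dot a a *: b + - (dot a b *: a)).
rewrite dotDl !dotDr !dotNl !dotNr !dotZl !dotZr (dotC b a) opprK.
have -> : dot a a * (dot a a * dot b b) + - (dot a a * (dot a b * dot a b)) +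
  (- (dot a b * (dot a a * dot a b)) + dot a b * (dot a b * dot a a)) =
  dot a a * (dot a a * dot b b - dot a b ^+ 2) by ring.
by rewrite pmulr_rge0// subr_ge0.
Qed.

Lemma dot_delta a (i : 'I_n) : dot (delta_mx 0 i) a = a 0 i.
Proof.
rewrite /dot (bigD1 i)//= big1 ?addr0; first by rewrite !mxE !eqxx mul1r.
by move=> j ji; rewrite !mxE (negbTE ji) mul0r.
Qed.

Lemma enorm_sqr a : enorm a ^+ 2 = dot a a.
Proof. by rewrite sqr_sqrtr// dot_ge0. Qed.

Definition frob A B : R := \sum_i \sum_j A i j * B i j.

Definition rank1 a b : 'M[R]_n := \matrix_(i, j) (a 0 i * b 0 j).

Lemma frobC A B : frob A B = frob B A.
Proof.
by apply: eq_bigr => i _; apply: eq_bigr => j _; rewrite mulrC.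
Qed.

Lemma frobDl A B D : frob (A + B) D = frob A D + frob B D.
Proof.
rewrite -big_split/=; apply: eq_bigr => i _; rewrite -big_split/=.
by apply: eq_bigr => j _; rewrite !mxE mulrDl.
Qed.

Lemma frobZl (s : R) A B : frob (s *: A) B = s * frob A B.
Proof.
rewrite mulr_sumr; apply: eq_bigr => i _; rewrite mulr_sumr.
by apply: eq_bigr => j _; rewrite !mxE mulrA.
Qed.

Lemma frobDr A B D : frob D (A + B) = frob D A + frob D B.
Proof. by rewrite frobC frobDl !(frobC D). Qed.

Lemma frobZr (s : R) A B : frob A (s *: B) = s * frob A B.
Proof. by rewrite frobC frobZl frobC. Qed.

Lemma frob_ge0 A : 0 <= frob A A.
Proof. by do 2!(apply: sumr_ge0 => ? _); rewrite -expr2 sqr_ge0. Qed.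

Lemma frob_eq0 A : frob A A = 0 -> A = 0.
Proof.
move=> A0; apply/matrixP => i j; rewrite mxE; apply/eqP.
rewrite -sqrf_eq0 eq_le sqr_ge0 andbT -A0 /frob (bigD1 i)//= (bigD1 j)//=.
rewrite -addrA -expr2 lerDl addr_ge0//.
  by apply: sumr_ge0 => ? _; rewrite -expr2 sqr_ge0.
by do 2!(apply: sumr_ge0 => ? _); rewrite -expr2 sqr_ge0.
Qed.

Lemma frob_rank1 A a b : frob A (rank1 a b) = dot (a *m A) b.
Proof.
rewrite /frob /dot exchange_big/=; apply: eq_bigr => j _.
rewrite !mxE mulr_suml; apply: eq_bigr => i _.
by rewrite !mxE mulrA [A i j * _]mulrC.
Qed.

Lemma mulmx_rank1 a b c : c *m rank1 a b = dot c a *: b.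
Proof.
apply/rowP => j; rewrite !mxE mulr_suml; apply: eq_bigr => i _.
by rewrite mxE mulrA.
Qed.

Lemma tr_sym A i j : A^T = A -> A i j = A j i.
Proof. by move=> /matrixP/(_ j i); rewrite mxE. Qed.

Lemma dot_mulmx A a b : A^T = A -> dot (a *m A) b = dot a (b *m A).
Proof.
move=> sA; rewrite -frob_rank1 dotC -frob_rank1 /frob exchange_big/=.
apply: eq_bigr => i _; apply: eq_bigr => j _.
by rewrite !mxE (tr_sym j i sA) [a 0 _ * _]mulrC.
Qed.

Lemma tr_rank1 a b : \tr (rank1 a b) = dot a b.
Proof. by apply: eq_bigr => i _; rewrite mxE. Qed.

Lemma tr_sqr A : A^T = A -> \tr (A *m A) = frob A A.
Proof.
move=> sA; apply: eq_bigr => i _; rewrite mxE; apply: eq_bigr => j _.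
by rewrite (tr_sym j i sA).
Qed.

Lemma slope_inv (m q : R) : 0 < m -> m ^+ 2 * (1 + q) = 1 ->
  q = (m ^+ 2)^-1 - 1.
Proof.
move=> m0 mq; have m20 : m ^+ 2 != 0 by rewrite expf_neq0// lt0r_neq0.
have <- : 1 + q = (m ^+ 2)^-1 by apply: (mulfI m20); rewrite mq divff.
by ring.
Qed.

(** The vectors [frame g m k] are the rows of the square root of the
    coefficient matrix [I - m^2 g g^T]. Summing second derivatives along them
    gives the elliptic operator, and at a maximum each summand is nonpositive. *)
Definition frame (g : 'rV[R]_n) (m : R) (k : 'I_n) : 'rV[R]_n :=
  delta_mx 0 k - (m ^+ 2 / (1 + m) * g 0 k) *: g.

Lemma frame_sum (g : 'rV[R]_n) (m : R) A : 0 < m ->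
  m ^+ 2 * (1 + dot g g) = 1 ->
  \sum_k frob A (rank1 (frame g m k) (frame g m k)) =
  \tr A - m ^+ 2 * frob A (rank1 g g).
Proof.
move=> m0 mq; set c := m ^+ 2 / (1 + m).
have qE := slope_inv m0 mq.
pose G := frob A (rank1 g g).
have E k : frob A (rank1 (frame g m k) (frame g m k)) =
    A k k - c * (g 0 k * frob A (rank1 g (delta_mx 0 k)))
    - c * (g 0 k * frob A (rank1 (delta_mx 0 k) g))
    + c ^+ 2 * G * (g 0 k * g 0 k).
  rewrite /G !frob_rank1 /frame -/c mulmxDl mulNmx -scalemxAl.
  rewrite dotDl !dotDr !dotNl !dotNr !dotZl !dotZr.
  have -> : dot (delta_mx 0 k *m A) (delta_mx 0 k) = A k k.
    by rewrite dotC dot_delta -rowE mxE.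
  by ring.
rewrite (eq_bigr _ (fun k _ => E k)) big_split/= !sumrB/= -!mulr_sumr.
have -> : \sum_k g 0 k * frob A (rank1 g (delta_mx 0 k)) = G.
  rewrite /G frob_rank1; apply: eq_bigr => k _.
  by rewrite frob_rank1 [in LHS]dotC dot_delta mulrC.
have -> : \sum_k g 0 k * frob A (rank1 (delta_mx 0 k) g) = G.
  rewrite /G /frob; under eq_bigr do rewrite mulr_sumr.
  rewrite exchange_big/=; apply: eq_bigr => i _.
  under eq_bigr do rewrite mulr_sumr.
  rewrite exchange_big/=; apply: eq_bigr => j _.
  rewrite (bigD1 i)//= big1 ?addr0; first by rewrite !mxE !eqxx/=; ring.
  by move=> k ki; rewrite !mxE [i == k]eq_sym (negbTE ki) andbF mul0r !mulr0.
rewrite -/(dot g g) -/G qE /c /mxtrace; field.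
by rewrite !lt0r_neq0// addr_gt0.
Qed.

(** The computation behind the theorem. With [g], [H] the gradient and Hessian
    of [u], [m] the factor [(1 + |g|^2)^(-1/2)], [Z] the derivative of [H] along
    [g], the last two hypotheses are the equation and its derivative along [g].
    Then [X] is the Hessian and [p] the gradient of [P], and the left-hand side
    is the linearized operator with a drift along [g], applied to [P].
    The matrix [W] is [H] compressed to the orthogonal complement of [g]. *)
Lemma P_function_identity (g : 'rV[R]_n) (H Z : 'M[R]_n) (m f f' : R) :
  let q := dot g g in
  let T := g *m H in
  let tau := dot T g in
  let p := f *: g + m ^+ 3 *: T in
  let W := H + (- q^-1) *: (rank1 g T + rank1 T g)
    + (tau / q ^+ 2) *: rank1 g g in
  let X := f' *: rank1 g g + f *: H + m ^+ 3 *: (H *m H + Z)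
    + (- (3 * m ^+ 5)) *: rank1 T T in
  H^T = H -> 0 < m -> m ^+ 2 * (1 + q) = 1 -> q != 0 ->
  m * \tr H - m ^+ 3 * tau + f = 0 ->
  - m ^+ 3 * tau * \tr H + m * \tr Z + 3 * m ^+ 5 * tau ^+ 2
    - m ^+ 3 * (2 * dot T T + frob Z (rank1 g g)) + f' * q = 0 ->
  \tr X - m ^+ 2 * frob X (rank1 g g) + (2 + q) * f * m / q * dot g p =
  m ^+ 3 * frob W W
  + (2 * dot p p / (m * q) - dot g p ^+ 2 * m * (1 + 2 * q) / q ^+ 2).
Proof.
move=> q T tau p W X sH m0 mq q0 eqn deqn.
have Tg : dot g T = tau by rewrite dotC.
have HT : frob H (rank1 T g) = dot T T.
  by rewrite frob_rank1 dot_mulmx.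
have HT' : frob H (rank1 g T) = dot T T by rewrite frob_rank1.
have Hg : frob H (rank1 g g) = tau by rewrite frob_rank1.
have HHg : frob (H *m H) (rank1 g g) = dot T T.
  by rewrite frob_rank1 mulmxA dot_mulmx.
have -> : frob W W = frob H H - 2 * dot T T / q + tau ^+ 2 / q ^+ 2.
  rewrite /W !frobDl !frobDr !frobZl !frobZr !frobDl !frobDr.
  rewrite !(frobC (rank1 _ _) H) HT HT' Hg !frob_rank1.
  rewrite !mulmx_rank1 !dotZl Tg -/q -/tau.
  by field.
have trX : \tr X = f' * q + f * \tr H + m ^+ 3 * (frob H H + \tr Z)
    - 3 * m ^+ 5 * dot T T.
  rewrite /X !mxtraceD !mxtraceZ !mxtraceD !tr_rank1 tr_sqr//.
  by rewrite /q; ring.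
have Xg : frob X (rank1 g g) = f' * q ^+ 2 + f * tau
    + m ^+ 3 * (dot T T + frob Z (rank1 g g)) - 3 * m ^+ 5 * tau ^+ 2.
  rewrite /X !frobDl !frobZl !frobDl HHg Hg !frob_rank1 !mulmx_rank1.
  by rewrite !dotZl Tg -/q -/tau; ring.
have pp : dot p p = f ^+ 2 * q + 2 * f * m ^+ 3 * tau + m ^+ 6 * dot T T.
  by rewrite /p dotDl !dotDr !dotZl !dotZr Tg -/q -/tau; ring.
have gp : dot g p = f * q + m ^+ 3 * tau by rewrite /p dotDr !dotZr Tg.
rewrite trX Xg pp gp.
have fE : f = m ^+ 3 * tau - m * \tr H by rewrite -[LHS]subr0 -eqn; ring.
have m_neq0 : m != 0 by rewrite lt0r_neq0.
have qE : q = (m ^+ 2)^-1 - 1 := slope_inv m0 mq.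
have f'E : f' = (m ^+ 3 * tau * \tr H - m * \tr Z - 3 * m ^+ 5 * tau ^+ 2
    + m ^+ 3 * (2 * dot T T + frob Z (rank1 g g))) / q.
  by apply: (mulIf q0); rewrite divfK// -[LHS]subr0 -deqn; ring.
move: q0; rewrite f'E fE qE.
clear eqn deqn fE qE f'E trX Xg pp gp Tg HT HT' Hg HHg W X p mq.
move: (\tr H) (\tr Z) (frob Z _) (dot T T) tau (frob H H) => h z zg t s hh q0.
field; rewrite m_neq0/=; apply: contraNneq q0 => E.
have -> : m ^- 2 - 1 = (1 + -1 * m ^+ 2) / m ^+ 2 by field.
by rewrite E mul0r.
Qed.

(** [2 |p|^2 / (m q)] dominates the negative term since
    [s^2 <= q |p|^2] and [m^2 (1 + 2 q) <= 2]. *)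
Lemma gradient_terms_ge0 (g p : 'rV[R]_n) (m : R) :
  let q := dot g g in
  0 < m -> m ^+ 2 * (1 + q) = 1 -> 0 < q ->
  0 <= 2 * dot p p / (m * q) - dot g p ^+ 2 * m * (1 + 2 * q) / q ^+ 2.
Proof.
move=> q m0 mq q0; have := cauchy_schwarz g p; rewrite -/q.
move: (dot p p) (dot g p) => pp s cs.
have -> : 2 * pp / (m * q) - s ^+ 2 * m * (1 + 2 * q) / q ^+ 2 =
    (2 * (q * pp - s ^+ 2) + s ^+ 2 * (2 - m ^+ 2 * (1 + 2 * q))) / (m * q ^+ 2).
  by field; rewrite !lt0r_neq0.
rewrite divr_ge0//; last by rewrite mulr_ge0 ?sqr_ge0 ?ltW.
rewrite addr_ge0// mulr_ge0 ?sqr_ge0 ?subr_ge0//.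
have -> : m ^+ 2 * (1 + 2 * q) = 2 * (m ^+ 2 * (1 + q)) - m ^+ 2 by ring.
by rewrite mq mulr1 gerBl sqr_ge0.
Qed.

End frobenius.

(** * The P-function of a solution *)

Definition isqrt1 (R : realType) (s : R) : R := (Num.sqrt (1 + s))^-1.

Section isqrt1_calculus.
Context (R : realType).
Implicit Types s t : R.

Lemma isqrt1_gt0 s : -1 < s -> 0 < isqrt1 s.
Proof. by move=> s1; rewrite invr_gt0 sqrtr_gt0 -ltrBlDl sub0r. Qed.

Lemma isqrt1_sqr s : -1 < s -> isqrt1 s ^+ 2 * (1 + s) = 1.
Proof.
move=> s1; have s1' : 0 < 1 + s by rewrite -ltrBlDl sub0r.
by rewrite exprVn sqr_sqrtr ?ltW// mulVf// gt_eqF.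
Qed.

Lemma is_derive_isqrt1 s : -1 < s ->
  is_derive s 1 (@isqrt1 R) (- (1 / 2) * isqrt1 s ^+ 3).
Proof.
move=> s1; have s1' : 0 < 1 + s by rewrite -ltrBlDl sub0r.
have r0 : 0 < Num.sqrt (1 + s) by rewrite sqrtr_gt0.
have d1 : is_derive s 1 (fun t => 1 + t) 1.
  have -> : (fun t => 1 + t) = (fun t : R => 1 + t * 1).
    by apply/funext => t; rewrite mulr1.
  exact: is_derive_affine.
have d2 : is_derive s 1 (Num.sqrt \o (fun t => 1 + t))
    ((2 * Num.sqrt (1 + s))^-1 * 1).
  by apply: is_derive1_comp; exact: is_derive1_sqrt.
have /= := @is_deriveV R _ s _ _ (lt0r_neq0 r0) d2.
move=> h; apply: is_derive_eq; rewrite /isqrt1 [_ *: _](erefl (_ * _)).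
by field; rewrite lt0r_neq0.
Qed.

Lemma is_derive_isqrt1' s : -1 < s ->
  is_derive s 1 (fun t => - (1 / 2) * isqrt1 t ^+ 3) (3 / 4 * isqrt1 s ^+ 5).
Proof.
move=> s1; have d := is_derive_isqrt1 s1.
have -> : (fun t => - (1 / 2) * isqrt1 t ^+ 3) =
    (- (1 / 2) : R) *: (fun t => isqrt1 t * (isqrt1 t * isqrt1 t)).
  by apply/funext => t; rewrite /= !exprS expr0 mulr1.
have h := is_deriveZ (- (1 / 2)) (is_derive_mul d (is_derive_mul d d)).
by apply: is_derive_eq; rewrite [_ *: _](erefl (_ * _)); field.
Qed.

End isqrt1_calculus.

Definition hess (R : realType) n (u : 'rV[R]_n -> R) (x : 'rV[R]_n) : 'M[R]_n :=
  \matrix_(i, j) partial j (partial i u) x.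

Definition slope (R : realType) n (u : 'rV[R]_n -> R) (x : 'rV[R]_n) : R :=
  isqrt1 (dot (grad u x) (grad u x)).

Definition dhess (R : realType) n (u : 'rV[R]_n -> R) (x w : 'rV[R]_n)
  : 'M[R]_n := \matrix_(i, j) dot w (grad (partial j (partial i u)) x).

Lemma derive_along_line (R : realType) n (g : 'rV[R]_n -> R) x w (d : R) :
  is_derive (0 : R) 1 (fun s : R => g (x + s *: w)) d -> 'D_w g x = d.
Proof.
move=> [_ <-]; rewrite /derive.
have -> // : (fun h : R => h^-1 *: (g (h *: w + x) - g x)) =
  (fun h : R => h^-1 *: (g (x + (h *: 1 + 0) *: w) - g (x + 0 *: w))).
apply/funext => h.
by rewrite addr0 scale0r addr0 [h *: 1]mulr1 [h *: w + x]addrC.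
Qed.

Lemma partial_along_line (R : realType) n (g : 'rV[R]_n -> R) x i (d : R) :
  is_derive (0 : R) 1 (fun s : R => g (x + s *: delta_mx 0 i)) d ->
  partial i g x = d.
Proof. exact: derive_along_line. Qed.

Lemma near_eq_partial (R : realType) n (g h : 'rV[R]_n -> R) x i :
  (\forall y \near x, g y = h y) -> partial i g x = partial i h x.
Proof. exact: near_eq_derive. Qed.

Section solution_calculus.
Context (R : realType) (n : nat) (Omega : set 'rV[R]_n).
Hypothesis oO : open Omega.
Variable u : 'rV[R]_n -> R.
Hypothesis hu3 : Ck 3 Omega u.
Implicit Types (x z w : 'rV[R]_n).

Lemma dot_gtN1 (v : 'rV[R]_n) : -1 < dot v v.
Proof. by rewrite (lt_le_trans _ (dot_ge0 v))// oppr_lt0. Qed.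

Lemma slope_gt0 x : 0 < slope u x.
Proof. by rewrite isqrt1_gt0// dot_gtN1. Qed.

Lemma slope_sqr x : slope u x ^+ 2 * (1 + dot (grad u x) (grad u x)) = 1.
Proof. by rewrite isqrt1_sqr// dot_gtN1. Qed.

Lemma hess_sym x : Omega x -> (hess u x)^T = hess u x.
Proof.
move=> Ox; apply/matrixP => i j; rewrite !mxE.
exact: (partialC oO _ _ (CkW hu3) Ox).
Qed.

Lemma dot_grad_partial x w i : Omega x ->
  dot w (grad (partial i u) x) = (w *m hess u x) 0 i.
Proof.
move=> Ox; rewrite mxE; apply: eq_bigr => j _.
rewrite [in LHS]mxE.
rewrite [in RHS]mxE.
by rewrite (partialC oO j i (CkW hu3) Ox).
Qed.

(** The third derivatives that arise from differentiating the squared length of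
    the gradient twice are those of the differentiated equation. *)
Lemma dhess_third x w i : Omega x ->
  \sum_j w 0 j * dot w (grad (partial j (partial i u)) x) =
  \sum_j \sum_l w 0 j * w 0 l * partial i (partial l (partial j u)) x.
Proof.
move=> Ox; apply: eq_bigr => j _; rewrite mulr_sumr; apply: eq_bigr => l _.
rewrite !mxE mulrA -(partialC oO l i (Ck_partial j hu3) Ox).
apply: (congr1 ( *%R (w 0 j * w 0 l))); apply: near_eq_partial.
have hO : \forall y \near x, Omega y by exact: open_nbhs_nbhs.
by apply: filterS hO => y Oy; exact: (partialC oO j i (CkW hu3) Oy).
Qed.

Lemma is_derive_partial z w i (t : R) : Omega (z + t *: w) ->
  is_derive t 1 (fun s : R => partial i u (z + s *: w))
    ((w *m hess u (z + t *: w)) 0 i).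
Proof.
move=> Ox; rewrite -dot_grad_partial//.
exact: (C1_is_derive_line oO (CkW (Ck_partial i hu3))).
Qed.

Lemma is_derive_slope z w (t : R) : Omega (z + t *: w) ->
  is_derive t 1 (fun s : R => slope u (z + s *: w))
    (- slope u (z + t *: w) ^+ 3 *
     dot (w *m hess u (z + t *: w)) (grad u (z + t *: w))).
Proof.
move=> Ox; set x := z + t *: w.
have dq : is_derive t 1
    (fun s : R => dot (grad u (z + s *: w)) (grad u (z + s *: w)))
    (2 * dot (w *m hess u x) (grad u x)).
  have -> : (fun s : R => dot (grad u (z + s *: w)) (grad u (z + s *: w))) =
    (fun s => \sum_i partial i u (z + s *: w) * partial i u (z + s *: w)).
    by apply/funext => s; apply: eq_bigr => i _; rewrite !mxE.
  rewrite mulr_sumr; apply: is_derive_sumE => i.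
  have := is_derive_mul (is_derive_partial i Ox) (is_derive_partial i Ox).
  by move=> h; apply: is_derive_eq; rewrite -/x [grad u x 0 i]mxE; ring.
have := @is_derive1_comp _ (@isqrt1 R) _ _ _ _
  (is_derive_isqrt1 (dot_gtN1 (grad u x))) dq.
by move=> h; apply: (is_derive_eq h); rewrite -/(slope u x); field.
Qed.

Lemma is_derive_hess z w i j (t : R) : Omega (z + t *: w) ->
  is_derive t 1 (fun s : R => hess u (z + s *: w) i j)
    (dhess u (z + t *: w) w i j).
Proof.
move=> Ox; rewrite mxE.
have -> : (fun s : R => hess u (z + s *: w) i j) =
   (fun s : R => partial j (partial i u) (z + s *: w)).
  by apply/funext => s; rewrite mxE.
exact: (C1_is_derive_line oO (Ck_partial j (Ck_partial i hu3))).
Qed.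

Lemma mean_curvature_opE x : Omega x ->
  mean_curvature_op u x = slope u x * \tr (hess u x)
    - slope u x ^+ 3 * dot (grad u x *m hess u x) (grad u x).
Proof.
move=> Ox; have x0 w : x + 0 *: w = x by rewrite scale0r addr0.
have -> : mean_curvature_op u x = \sum_i (slope u x * hess u x i i
    - slope u x ^+ 3 * ((grad u x *m hess u x) 0 i * grad u x 0 i)).
  apply: eq_bigr => i _; apply: partial_along_line.
  set e := delta_mx 0 i.
  have -> : (fun s : R => ((Num.sqrt (1 + enorm (grad u (x + s *: e)) ^+ 2))^-1
      *: grad u (x + s *: e)) 0 i) =
    (fun s : R => slope u (x + s *: e) * partial i u (x + s *: e)).
    by apply/funext => s; rewrite enorm_sqr !mxE.
  have Ox0 : Omega (x + (0 : R) *: e) by rewrite x0.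
  have := is_derive_mul (is_derive_slope Ox0) (is_derive_partial i Ox0).
  rewrite x0 => h; apply: is_derive_eq.
  have -> : (e *m hess u x) 0 i = hess u x i i by rewrite /e -rowE mxE.
  have -> : dot (e *m hess u x) (grad u x) = (grad u x *m hess u x) 0 i.
    rewrite dot_mulmx; first by rewrite dot_delta.
    exact: hess_sym.
  have -> : partial i u x = grad u x 0 i by rewrite mxE.
  by ring.
by rewrite sumrB -!mulr_sumr.
Qed.

Variables (f f' F : R -> R).
Hypothesis hf : forall t : R, is_derive t 1 f (f' t).
Hypothesis hFf : forall t : R, is_derive t 1 F (f t).
Hypothesis equ : forall x, Omega x -> mean_curvature_op u x + f (u x) = 0.

Lemma equation_diff z : Omega z ->
  let g := grad u z in let H := hess u z in let Z := dhess u z g in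
  let m := slope u z in let tau := dot (g *m H) g in
  - m ^+ 3 * tau * \tr H + m * \tr Z + 3 * m ^+ 5 * tau ^+ 2
    - m ^+ 3 * (2 * dot (g *m H) (g *m H) + frob Z (rank1 g g))
    + f' (u z) * dot g g = 0.
Proof.
move=> Oz g H Z m tau.
have x0 : z + (0 : R) *: g = z by rewrite scale0r addr0.
have Oz0 : Omega (z + (0 : R) *: g) by rewrite x0.
pose E (s : R) := let x := z + s *: g in
  slope u x * \sum_i hess u x i i
  - slope u x * (slope u x * slope u x) *
    \sum_i \sum_j hess u x i j * (partial i u x * partial j u x) + f (u x).
have E0 : \forall s \near (0 : R), cst (0 : R) s = E s.
  have hn := near_line oO g Oz.
  apply: filterS hn => s Os; rewrite /cst -(equ Os) mean_curvature_opE//.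
  rewrite /E; set x := z + s *: g.
  have -> : \sum_i \sum_j hess u x i j * (partial i u x * partial j u x) =
      dot (grad u x *m hess u x) (grad u x).
    rewrite -frob_rank1; apply: eq_bigr => i _; apply: eq_bigr => j _.
    by rewrite [rank1 _ _ i j]mxE [grad u x 0 i]mxE [grad u x 0 j]mxE.
  by rewrite /mxtrace; ring.
have d0 : is_derive (0 : R) 1 E 0.
  by apply: (near_eq_is_derive E0); exact: is_derive_cst.
have gE k : g 0 k = partial k u z by rewrite mxE.
have dm := is_derive_slope Oz0.
have dh i j := is_derive_hess i j Oz0.
have dp i := is_derive_partial i Oz0.
have du := C1_is_derive_line oO (CkW (CkW hu3)) Oz0.
rewrite x0 -/g -/H -/Z -/m -/tau in dm dh dp du.
have dtr : is_derive (0 : R) 1 (fun s : R => \sum_i hess u (z + s *: g) i i)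
    (\tr Z) by apply: is_derive_sumE.
have dtau : is_derive (0 : R) 1 (fun s : R => \sum_i \sum_j
    hess u (z + s *: g) i j *
      (partial i u (z + s *: g) * partial j u (z + s *: g)))
    (2 * dot (g *m H) (g *m H) + frob Z (rank1 g g)).
  have -> : 2 * dot (g *m H) (g *m H) + frob Z (rank1 g g) = \sum_i \sum_j
      (Z i j * (g 0 i * g 0 j) +
       H i j * ((g *m H) 0 i * g 0 j + g 0 i * (g *m H) 0 j)).
    have -> : 2 * dot (g *m H) (g *m H) =
        frob H (rank1 (g *m H) g) + frob H (rank1 g (g *m H)).
      rewrite !frob_rank1 [X in X + _]dot_mulmx; first by rewrite mulr2n; ring.
      exact: hess_sym.
    rewrite addrC -frobDr /frob -big_split/=; apply: eq_bigr => i _.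
    by rewrite -big_split/=; apply: eq_bigr => j _; rewrite !mxE.
  apply: is_derive_sumE => i; apply: is_derive_sumE => j.
  have := is_derive_mul (dh i j) (is_derive_mul (dp i) (dp j)).
  by rewrite x0 => h; apply: (is_derive_eq h); rewrite !gE -/H.
have df : is_derive (0 : R) 1 (fun s : R => f (u (z + s *: g)))
    (f' (u z) * dot g g).
  by apply: is_derive1_comp du; rewrite x0; exact: hf.
have dE := is_deriveD (is_deriveB (is_derive_mul dm dtr)
  (is_derive_mul (is_derive_mul dm (is_derive_mul dm dm)) dtau)) df.
have := @derive_val _ _ _ _ _ _ _ d0.
have -> := @derive_val _ _ _ _ _ _ _ dE.
rewrite x0 => <-.
have -> : \sum_i \sum_j hess u z i j * (partial i u z * partial j u z) = tau.
  rewrite /tau -frob_rank1; apply: eq_bigr => i _; apply: eq_bigr => j _.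
  by rewrite !mxE.
by rewrite -/m -/H -[\sum_i H i i]/(\tr H); ring.
Qed.

Definition P_grad z : 'rV[R]_n :=
  f (u z) *: grad u z + slope u z ^+ 3 *: (grad u z *m hess u z).

Definition P_hess z : 'M[R]_n :=
  f' (u z) *: rank1 (grad u z) (grad u z) + f (u z) *: hess u z
  + slope u z ^+ 3 *: (hess u z *m hess u z + dhess u z (grad u z))
  + (- (3 * slope u z ^+ 5)) *:
    rank1 (grad u z *m hess u z) (grad u z *m hess u z).

Lemma jet2_sqr k z w (a b : R) : jet2 k z w a b ->
  jet2 (fun x => k x * k x) z w (2 * k z * a) (2 * a ^+ 2 + 2 * k z * b).
Proof.
move=> jk; have d2 (s : R) : is_derive s 1 (fun t => t * t) (2 * s).
  have := is_derive_mul (is_derive_id s 1) (is_derive_id s 1) => h.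
  by apply: is_derive_eq; ring.
have d2' : is_derive (k z) 1 (fun s => 2 * s) 2.
  have := is_deriveZ 2 (is_derive_id (k z) 1) => h.
  by apply: is_derive_eq; rewrite [_ *: _](erefl (_ * _)) mulr1.
exact: (jet2_comp (filterE _ d2) d2' jk).
Qed.

Lemma jet2_slope z w : Omega z ->
  jet2 (slope u) z w
    (- slope u z ^+ 3 * dot (w *m hess u z) (grad u z))
    (- slope u z ^+ 3 * (dot (w *m hess u z) (w *m hess u z)
       + frob (dhess u z (grad u z)) (rank1 w w))
     + 3 * slope u z ^+ 5 * dot (w *m hess u z) (grad u z) ^+ 2).
Proof.
move=> Oz.
have jp i := jet2_sqr (jet2_C2 oO w (Ck_partial i hu3) Oz).
have E1 : \sum_i 2 * partial i u z * dot w (grad (partial i u) z) =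
    2 * dot (w *m hess u z) (grad u z).
  rewrite mulr_sumr; apply: eq_bigr => i _.
  by rewrite (dot_grad_partial w i Oz) [grad u z 0 i]mxE; ring.
have E2 : \sum_i (2 * dot w (grad (partial i u) z) ^+ 2 + 2 * partial i u z *
     \sum_j w 0 j * dot w (grad (partial j (partial i u)) z)) =
  2 * (dot (w *m hess u z) (w *m hess u z)
       + frob (dhess u z (grad u z)) (rank1 w w)).
  rewrite big_split/= mulrDr; apply: f_equal2.
    rewrite mulr_sumr; apply: eq_bigr => i _.
    by rewrite (dot_grad_partial w i Oz) expr2.
  rewrite (eq_bigr (fun i => 2 * partial i u z * \sum_j \sum_l
      w 0 j * w 0 l * partial i (partial l (partial j u)) z)); last first.
    by move=> i _; rewrite (dhess_third w i Oz).
  rewrite /frob mulr_sumr; under eq_bigr do rewrite mulr_sumr.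
  rewrite exchange_big/=; apply: eq_bigr => j _.
  under eq_bigr do rewrite mulr_sumr.
  rewrite exchange_big/= mulr_sumr; apply: eq_bigr => l _.
  rewrite [dhess _ _ _ _ _]mxE mulr_suml mulr_sumr; apply: eq_bigr => i _.
  by rewrite [rank1 _ _ _ _]mxE [grad u z 0 i]mxE [grad _ z 0 i]mxE; ring.
have jq := jet2_eq (jet2_sum jp) E1 E2.
have qE : (fun x => \sum_i partial i u x * partial i u x) =
    (fun x => dot (grad u x) (grad u x)).
  by apply/funext => x; apply: eq_bigr => i _; rewrite !mxE.
rewrite qE in jq.
have near1 : \forall s \near dot (grad u z) (grad u z),
    is_derive (s : R) 1 (@isqrt1 R) (- (1 / 2) * isqrt1 s ^+ 3).
  have hlt : \forall s \near dot (grad u z) (grad u z), -1 < s.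
    by apply: lt_nbhsr; exact: dot_gtN1.
  by apply: filterS hlt => s; exact: is_derive_isqrt1.
have d2 := is_derive_isqrt1' (dot_gtN1 (grad u z)).
have h := @jet2_comp _ _ _ _ (fun x => dot (grad u x) (grad u x)) z w _ _ _
  near1 d2 jq.
by apply: (jet2_eq h); rewrite -/(slope u z); field.
Qed.

Lemma P_functionE x : P_function F u x = F (u x) - slope u x.
Proof. by rewrite /P_function enorm_sqr. Qed.

Lemma jet2_P z w : Omega z ->
  jet2 (P_function F u) z w (dot w (P_grad z))
    (frob (P_hess z) (rank1 w w)).
Proof.
move=> Oz; have sH := hess_sym Oz.
have ju := jet2_C2 oO w (CkW hu3) Oz.
have nF : \forall s \near u z, is_derive (s : R) 1 F (f s) by exact: filterE.
have jF := jet2_comp nF (hf (u z)) ju.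
have := jet2D jF (jet2Z (-1) (jet2_slope w Oz)).
have -> : (fun x => (F \o u) x + -1 * slope u x) = P_function F u.
  by apply/funext => x; rewrite P_functionE mulN1r.
move=> h; apply: (jet2_eq h).
  by rewrite /P_grad dotDr !dotZr dot_mulmx//; ring.
have -> : \sum_i w 0 i * dot w (grad (partial i u) z) =
    frob (hess u z) (rank1 w w).
  rewrite frob_rank1 dotC; apply: eq_bigr => i _.
  by rewrite dot_grad_partial.
rewrite /P_hess !frobDl !frobZl !frobDl !frob_rank1 !mulmx_rank1 !dotZl.
rewrite mulmxA [dot (w *m hess u z *m hess u z) w]dot_mulmx//.
rewrite [dot (grad u z *m hess u z) w]dot_mulmx// (dotC (grad u z)).
rewrite (dotC w (grad u z *m _)) [dot (grad u z *m hess u z) w]dot_mulmx//.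
by rewrite (dotC (grad u z)); ring.
Qed.

(** At a critical point of [P + k] the drift term of the inequality for [P]
    is minus the one for [k], so maximality leaves no room for a strict
    subsolution [k]. *)
Lemma subsolution_at_max z k dk K :
  let g := grad u z in let q := dot g g in let m := slope u z in
  Omega z -> grad u z != 0 ->
  (forall w, jet2 k z w (dot w dk) (frob K (rank1 w w))) ->
  (\forall x \near z, P_function F u x + k x <= P_function F u z + k z) ->
  \tr K - m ^+ 2 * frob K (rank1 g g) + (2 + q) * f (u z) * m / q * dot g dk
    <= 0.
Proof.
move=> g q m Oz gz jk zmax.
have q0 : 0 < q by rewrite dot_gt0.
have m0 : 0 < m := slope_gt0 z.
have mq : m ^+ 2 * (1 + q) = 1 := slope_sqr z.
have jets w := jet2_max (jet2D (jet2_P w Oz) (jk w)) zmax.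
have [gp _] := jets g.
have : \sum_k (frob (P_hess z) (rank1 (frame g m k) (frame g m k)) +
     frob K (rank1 (frame g m k) (frame g m k))) <= 0.
  by apply: sumr_le0 => i _; have [] := jets (frame g m i).
rewrite big_split/= !frame_sum// => le0.
have eqn : m * \tr (hess u z) - m ^+ 3 * dot (g *m hess u z) g + f (u z) = 0.
  by rewrite -(equ Oz) mean_curvature_opE.
have := P_function_identity (hess_sym Oz) m0 mq (lt0r_neq0 q0) eqn
  (equation_diff Oz).
rewrite -/g -/q -/(P_hess z) -/(P_grad z) => id.
have W0 := frob_ge0 (hess u z + - q^-1 *:
  (rank1 g (g *m hess u z) + rank1 (g *m hess u z) g) +
  (dot (g *m hess u z) g / q ^+ 2) *: rank1 g g).
have G0 := gradient_terms_ge0 (P_grad z) m0 mq q0.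
have m3 : 0 <= m ^+ 3 by rewrite exprn_ge0// ltW.
have := addr_ge0 (mulr_ge0 m3 W0) G0.
rewrite -id -/g -/q.
have -> : dot g dk = - dot g (P_grad z).
  by apply/eqP; rewrite -addr_eq0 addrC gp.
move: le0; rewrite mulrN; move: (_ * dot g (P_grad z)) (\tr K - _) (\tr _ - _).
by move=> a b c; lra.
Qed.

(** Where [P] is locally constant the inequality is an equality: all the
    discarded squares vanish. *)
Lemma hess_of_constant_P z : Omega z -> grad u z != 0 ->
  (\forall x \near z, P_function F u x = P_function F u z) ->
  let g := grad u z in
  hess u z = (- f (u z) / (slope u z ^+ 3 * dot g g)) *: rank1 g g.
Proof.
move=> Oz gz Pc g; set q := dot g g; set m := slope u z.
have q0 : 0 < q by rewrite dot_gt0.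
have m0 : 0 < m := slope_gt0 z.
have mq : m ^+ 2 * (1 + q) = 1 := slope_sqr z.
have Pg w : dot w (P_grad z) = 0 /\ frob (P_hess z) (rank1 w w) = 0.
  have le1 : \forall x \near z, P_function F u x <= P_function F u z.
    by apply: filterS Pc => x ->.
  have le2 : \forall x \near z, -1 * P_function F u x <= -1 * P_function F u z.
    by apply: filterS Pc => x ->.
  have [-> h1] := jet2_max (jet2_P w Oz) le1.
  have [_ h2] := jet2_max (jet2Z (-1) (jet2_P w Oz)) le2.
  by split=> //; apply/eqP; rewrite eq_le h1 -oppr_le0 -mulN1r.
have p0 : P_grad z = 0 by apply/eqP; rewrite -dot_eq0 (Pg _).1.
have S0 : \sum_k frob (P_hess z) (rank1 (frame g m k) (frame g m k)) = 0.
  by rewrite big1// => i _; rewrite (Pg _).2.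
rewrite frame_sum// in S0.
have eqn : m * \tr (hess u z) - m ^+ 3 * dot (g *m hess u z) g + f (u z) = 0.
  by rewrite -(equ Oz) mean_curvature_opE.
have := P_function_identity (hess_sym Oz) m0 mq (lt0r_neq0 q0) eqn
  (equation_diff Oz).
rewrite -/g -/q -/(P_hess z) -/(P_grad z) S0 p0.
have m30 : m ^+ 3 != 0 by rewrite expf_neq0// lt0r_neq0.
set c := - f (u z) / m ^+ 3.
have T : g *m hess u z = c *: g.
  apply: (scalerI m30); rewrite scalerA mulrC divfK// scaleNr.
  by apply/eqP; rewrite -addr_eq0 addrC; apply/eqP.
rewrite !dot0r T; set W := hess u z + _ + _ => E.
have /frob_eq0 W0 : frob W W = 0.
  apply: (mulfI m30); rewrite mulr0; move: E.
  by rewrite expr0n !mulr0 !mul0r subrr !addr0.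
have -> : hess u z = W + (c / q) *: rank1 g g.
  rewrite /W dotZl -/q; move: (hess u z) => H0.
  by apply/matrixP => i j; rewrite !mxE; field; rewrite lt0r_neq0.
rewrite W0 add0r; congr (_ *: _); rewrite /c; field.
by rewrite !lt0r_neq0.
Qed.

End solution_calculus.

(** * The gradient at the boundary *)

Lemma near_closure_meet (T : topologicalType) (A : set T) p (Q : T -> Prop) :
  closure A p -> (\forall x \near p, Q x) -> exists2 x, A x & Q x.
Proof. by move=> cA /cA[x [Ax Qx]]; exists x. Qed.

Section linear_forms.
Context (R : realType) (n : nat).
Implicit Types (v w c : 'rV[R]_n).

Lemma row_coord_sum (v : 'rV[R]_n) k :
  \sum_j v 0 j * (delta_mx 0 j : 'rV[R]_n) 0 k = v 0 k.
Proof.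
rewrite (bigD1 k)//= big1 ?addr0; first by rewrite mxE !eqxx mulr1.
by move=> j jk; rewrite mxE [k == j]eq_sym (negbTE jk) andbF mulr0.
Qed.

Lemma cvg_sumE (T : Type) (F : set_system T) (FF : Filter F)
    (h : 'I_n -> T -> R) (a : 'I_n -> R) :
  (forall i, h i @ F --> a i) ->
  (fun x => \sum_i h i x) @ F --> \sum_i a i.
Proof.
move=> ha; rewrite (_ : (fun x => _) = \sum_(i < n) h i); last first.
  by apply/funext => x; rewrite fct_sumE.
apply: (big_ind2 (fun (k : T -> R) (l : R) => k @ F --> l)).
- exact: cvg_cst.
- by move=> k1 l1 k2 l2 h1 h2; exact: cvgD.
- by move=> i _; exact: ha.
Qed.

Lemma dot_cvg (T : Type) (F : set_system T) (FF : Filter F)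
    (f g : T -> 'rV[R]_n) (a b : 'rV[R]_n) :
  f @ F --> a -> g @ F --> b -> (fun x => dot (f x) (g x)) @ F --> dot a b.
Proof.
move=> fa gb; have coord h (c : 'rV[R]_n) i : h @ F --> c ->
    (fun x => h x 0 i) @ F --> c 0 i.
  move=> hc; have cc : {for c, continuous (fun M : 'rV[R]_n => M 0 i)}.
    exact: coord_continuous.
  exact: (continuous_cvg FF cc hc).
by apply: cvg_sumE => i; apply: cvgM; exact: coord.
Qed.

(** A form that is nonnegative on an open half-space is nonnegative on its
    boundary hyperplane, hence zero there, hence a multiple of the form that
    defines the half-space. *)
Lemma perp_of_half_space (N v : 'rV[R]_n) :
  (forall w, dot w N < 0 -> 0 <= dot w v) -> N != 0 ->
  dot v N ^+ 2 = dot N N * dot v v.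
Proof.
move=> H N0; have NN : 0 < dot N N by rewrite dot_gt0.
have H0 w : dot w N = 0 -> 0 <= dot w v.
  move=> wN; apply/ler_addgt0Pr => e e0.
  pose d := e / (1 + `|dot N v|).
  have d0 : 0 < d by rewrite divr_gt0// ltr_pwDl.
  have : 0 <= dot (w - d *: N) v.
    apply: H; rewrite dotDl wN add0r dotNl dotZl oppr_lt0; exact: mulr_gt0.
  rewrite dotDl dotNl dotZl subr_ge0 => h.
  suff : `|d * dot N v| <= e.
    by rewrite ler_norml => /andP[h1 _]; rewrite -lerBlDr sub0r (le_trans h1).
  rewrite normrM (gtr0_norm d0) /d mulrAC ler_pdivrMr ?ltr_pwDl//.
  by rewrite (ler_pM2l e0) lerDr.
pose t := dot N N *: v - dot v N *: N.
have tN : dot t N = 0 by rewrite /t dotDl dotNl !dotZl; ring.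
have t1 := H0 t tN.
have t2 : 0 <= dot (- t) v by apply: H0; rewrite dotNl tN oppr0.
have : dot t v = 0 by apply/eqP; rewrite eq_le t1 -oppr_ge0 -dotNl t2.
rewrite /t dotDl dotNl !dotZl (dotC N v) => /eqP; rewrite subr_eq0 => /eqP ->.
by rewrite expr2.
Qed.

End linear_forms.

Section boundary_gradient.
Context (R : realType) (n : nat) (Omega : set 'rV[R]_n).
Hypothesis oO : open Omega.
Variables (u : 'rV[R]_n -> R) (G : 'rV[R]_n -> 'rV[R]_n).
Hypothesis Cu : Ck 1 Omega u.
Hypothesis cu : {within closure Omega, continuous u}.
Hypothesis cG : {within closure Omega, continuous G}.
Hypothesis GE : forall x, Omega x -> G x = grad u x.
Hypothesis u_gt0 : forall x, Omega x -> 0 < u x.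
Implicit Types (p x w : 'rV[R]_n).

Lemma boundary_gradE p : closure Omega p -> boundary_grad Omega u p = G p.
Proof.
move=> cp; have PF : ProperFilter (within Omega (nbhs p)).
  exact: within_nbhs_proper.
apply: cvg_lim => //.
have : G @ within Omega (nbhs p) --> G p.
  have /subspace_continuousP/(_ p cp) := cG; apply: cvg_trans.
  apply: cvg_fmap2 => A /= hA; rewrite /within/=.
  have : \forall x \near p, closure Omega x -> A x by exact: hA.
  by move=> {}hA; apply: filterS hA => x h Ox; apply: h; exact: subset_closure.
apply: cvg_trans; apply: near_eq_cvg.
have nO : \forall x \near p, Omega x -> G x = grad u x.
  by apply: filterE; exact: GE.
exact: nO.
Qed.

(** [u] vanishes at [p] and is positive inside, so it cannot start out
    decreasing along a segment that enters [Omega]. *)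
Lemma entering_derivative_ge0 p w : closure Omega p -> u p = 0 ->
  (exists2 r : R, 0 < r & forall t : R, 0 < t < r -> Omega (p + t *: w)) ->
  0 <= dot w (G p).
Proof.
move=> cp up [r r0 hr]; rewrite leNgt; apply/negP => wG.
have lineP (A : set 'rV[R]_n) : nbhs p A ->
    exists2 s : R, 0 < s & forall t : R, 0 < t < s -> A (p + t *: w).
  move=> /(line_cvg0 w) /nbhs_ballP[s /= s0 hs]; exists s => // t /andP[t0 ts].
  by apply: hs; rewrite /ball/= sub0r normrN gtr0_norm.
have [r1 r10 hr1] : exists2 s : R, 0 < s & forall t : R, 0 < t < s ->
    Omega (p + t *: w) -> dot w (G (p + t *: w)) < 0.
  have /subspace_continuousP/(_ p cp) cGp := cG.
  have dG : (fun x => dot w (G x)) @ within (closure Omega) (nbhs p)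
      --> dot w (G p).
    by apply: dot_cvg cGp; exact: cvg_cst.
  have hn : \forall x \near p, closure Omega x -> dot w (G x) < 0.
    exact: (cvgr_lt _ dG _ wG).
  have [s s0 hs] := lineP _ hn.
  by exists s => // t ts Ot; apply: hs => //; exact: subset_closure.
pose t := Num.min r r1 / 2.
have m0 : 0 < Num.min r r1 by rewrite lt_min r0 r10.
have t0 : 0 < t by rewrite divr_gt0.
have : t < Num.min r r1 by rewrite /t ltr_pdivrMr// ltr_pMr// ltr1n.
rewrite lt_min => /andP[tr tr1].
have Ot : Omega (p + t *: w) by apply: hr; rewrite t0.
have mono (s : R) : 0 < s < t -> u (p + t *: w) <= u (p + s *: w).
  move=> /andP[s0 st].
  have line (x : R) : s <= x <= t -> Omega (p + x *: w).
    move=> /andP[sx xt]; apply: hr.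
    by rewrite (lt_le_trans s0 sx) (le_lt_trans xt tr).
  have [||c] := @MVT R (fun y : R => u (p + y *: w))
    (fun y : R => dot w (grad u (p + y *: w))) s t st.
  - move=> x; rewrite in_itv/= => /andP[sx xt].
    by apply: (C1_is_derive_line oO Cu); apply: line; rewrite !ltW.
  - apply: derivable_within_continuous => x; rewrite in_itv/= => sxt.
    by have [] := C1_is_derive_line oO Cu (line _ sxt).
  rewrite in_itv/= => /andP[sc ct] E; rewrite -subr_le0 E.
  have Oc : Omega (p + c *: w) by apply: line; rewrite !ltW.
  rewrite mulr_le0_ge0 ?subr_ge0 ?(ltW st)//.
  rewrite -GE// ltW//; apply: hr1 => //.
  by rewrite (lt_trans s0 sc) (lt_trans ct tr1).
have /subspace_continuousP/(_ p cp) cup := cu.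
have ut : u p < u (p + t *: w) by rewrite up u_gt0.
have hn : \forall x \near p, closure Omega x -> u x < u (p + t *: w).
  exact: (cvgr_lt _ cup _ ut).
have [s s0 hs] := lineP _ hn.
pose s' := Num.min s t / 2.
have m'0 : 0 < Num.min s t by rewrite lt_min s0 t0.
have s'0 : 0 < s' by rewrite divr_gt0.
have : s' < Num.min s t by rewrite /s' ltr_pdivrMr// ltr_pMr// ltr1n.
rewrite lt_min => /andP[ss st].
have /hs : 0 < s' < s by rewrite s'0.
have Os' : Omega (p + s' *: w).
  by apply: hr; rewrite s'0 (lt_trans st tr).
move=> /(_ (subset_closure Os')); apply/negP; rewrite -leNgt.
by apply: mono; rewrite s'0.
Qed.

(** Every direction in which the defining function of the chart decreases
    enters [Omega], so the gradient is normal to the boundary and its length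
    is the modulus of the normal derivative. *)
Lemma boundary_gradient_norm (kappa : R) p : boundary Omega p -> u p = 0 ->
  (exists i b phi, C1_chart Omega p i b phi) ->
  (forall nu, exterior_normal Omega p nu ->
    normal_derivative Omega u p nu = kappa) ->
  dot (G p) (G p) = kappa ^+ 2.
Proof.
move=> [cp nip] up [i [b [phi chart]]] hk.
have [Cphi [r r0 hr]] := chart.
set sg : R := (-1) ^+ b in hr.
have sg2 : sg * sg = 1.
  by rewrite /sg; case: b {hk hr chart sg}; rewrite ?expr1 ?expr0 ?mulrNN mulr1.
(* [Omega] is [h < 0] near [p]; [L] is the differential of [h] at [p]. *)
pose h x := phi (col' i x) - sg * x 0 i.
pose D := grad phi (col' i p).
pose L w := dot (col' i w) D - sg * w 0 i.
have dh w : is_derive (0 : R) 1 (fun t : R => h (p + t *: w)) (L w).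
  have -> : (fun t : R => h (p + t *: w)) =
      (fun t : R => phi (col' i p + t *: col' i w)) \-
      (fun t : R => sg * p 0 i + t * (sg * w 0 i)).
    apply/funext => t; rewrite /h /= !mxE; congr (_ - _); last by ring.
    by congr phi; apply/rowP => j; rewrite !mxE.
  apply: is_deriveB; last exact: is_derive_affine.
  have := @C1_is_derive_line _ _ _ openT phi (col' i p) (col' i w) 0 Cphi I.
  by rewrite scale0r addr0.
have NE w : dot w (grad h p) = L w.
  have -> : dot w (grad h p) = \sum_j w 0 j * L (delta_mx 0 j).
    apply: eq_bigr => j _; rewrite mxE.
    by rewrite (partial_along_line (dh (delta_mx 0 j))).
  rewrite /L; under eq_bigr do rewrite mulrBr.
  rewrite sumrB; congr (_ - _).
    transitivity (\sum_j \sum_k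
        w 0 j * ((col' i (delta_mx 0 j : 'rV[R]_n)) 0 k * D 0 k)).
      by apply: eq_bigr => j _; rewrite mulr_sumr.
    rewrite exchange_big/=; apply: eq_bigr => k _.
    rewrite [(col' i w) 0 k]mxE -(row_coord_sum w) mulr_suml.
    by apply: eq_bigr => j _; rewrite [(col' _ _) 0 k]mxE mulrA.
  under eq_bigr do rewrite mulrCA.
  by rewrite -mulr_sumr row_coord_sum.
set N := grad h p in NE.
have N0 : N != 0.
  apply/eqP => N0; have := NE (delta_mx 0 i).
  rewrite N0 dot0r /L mxE !eqxx/= mulr1.
  have -> : col' i (delta_mx 0 i) = 0 :> 'rV[R]_n.-1.
    by apply/rowP => j; rewrite !mxE eq_sym (negbTE (neq_lift _ _)) andbF.
  rewrite dot0l sub0r => /eqP.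
  rewrite eq_sym oppr_eq0 => /eqP sg0; move: sg2.
  by rewrite sg0 mul0r => /eqP; rewrite eq_sym oner_eq0.
have hp : h p <= 0.
  rewrite leNgt; apply/negP => hp.
  have cc : {for col' i p, continuous phi} by have [c _] := Cphi; exact: c.
  have colc : (fun x : 'rV[R]_n => col' i x) @ p --> col' i p.
    move=> A /nbhs_ballP[e /= e0 hA].
    have hb : \forall x \near p, ball p e x by exact: nbhsx_ballx.
    suff : \forall x \near p, A (col' i x) by [].
    apply: filterS hb => x /row_ballP[_ px]; apply: hA; apply/row_ballP.
    by split=> // j; rewrite !mxE; exact: px.
  have ch : h @ p --> h p.
    have c1 : (fun x : 'rV[R]_n => phi (col' i x)) @ p --> phi (col' i p).
      exact: (continuous_cvg _ cc colc).
    have c2 : (fun x : 'rV[R]_n => sg * x 0 i) @ p --> sg * p 0 i.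
      have c3 : (fun x : 'rV[R]_n => x 0 i) @ p --> p 0 i.
        exact: coord_continuous.
      exact: (cvgM (cvg_cst sg) c3).
    exact: (cvgB c1 c2).
  have nh : \forall x \near p, 0 < h x /\ ball p r x.
    by apply: filterI; [exact: (cvgr_gt _ ch _ hp)|exact: nbhsx_ballx].
  have [x Ox [hx px]] := near_closure_meet cp nh.
  have := (hr x px).1 Ox; rewrite -subr_lt0 -/(h x) => /lt_trans/(_ hx).
  by rewrite ltxx.
have half w : dot w N < 0 -> 0 <= dot w (G p).
  rewrite NE => Lw; apply: entering_derivative_ge0 => //.
  have L2 : 0 < - L w / 2 by rewrite divr_gt0// oppr_gt0.
  have [s s0 hs] := is_derive_expansion_inv (dh w) L2.
  have nb : \forall x \near p, ball p r x by exact: nbhsx_ballx.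
  have /nbhs_ballP[s' /= s'0 hs'] := line_cvg0 w nb.
  exists (Num.min s s'); first by rewrite lt_min s0 s'0.
  move=> t /andP[t0]; rewrite lt_min => /andP[ts ts'].
  apply/hr; first by apply: hs'; rewrite /ball/= sub0r normrN gtr0_norm.
  have := hs t; rewrite gtr0_norm// add0r scale0r addr0 => /(_ ts).
  rewrite ler_norml => /andP[_ ht]; rewrite -subr_lt0 -/(h _).
  have tL : t * L w < 0 by rewrite pmulr_rlt0.
  have aux (x y c : R) : y <= 0 -> t * c < 0 -> x - y - t * c <= - c / 2 * t ->
    x < 0 by move=> *; lra.
  exact: aux hp tL ht.
have := perp_of_half_space half N0.
have ext : exterior_normal Omega p ((enorm N)^-1 *: N).
  by exists i, b, phi.
have := hk _ ext; rewrite /normal_derivative boundary_gradE// dotZr => <-.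
move=> E; rewrite exprMn E exprVn enorm_sqr mulKf// lt0r_neq0// dot_gt0//.
Qed.

End boundary_gradient.

(** * The exponential of the solution as a subsolution *)

Section sqdist.
Context (R : realType) (n : nat).
Implicit Types (x y : 'rV[R]_n) (A : set 'rV[R]_n).

Lemma sqdist_continuous y : continuous (fun x => dot (x - y) (x - y)).
Proof.
move=> x; have c : (fun x => x - y) @ x --> x - y.
  have c1 : (fun x : 'rV[R]_n => x) @ x --> x by move=> B.
  exact: (cvgB c1 (cvg_cst y)).
exact: (@dot_cvg R n _ (nbhs x) _ (fun x => x - y) (fun x => x - y) _ _ c c).
Qed.

Lemma coord_sqr_le_dot (v : 'rV[R]_n) j : v 0 j ^+ 2 <= dot v v.
Proof.
rewrite /dot (bigD1 j)//= -expr2 lerDl.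
by apply: sumr_ge0 => k _; rewrite -expr2 sqr_ge0.
Qed.

Lemma sqdist_ball x y (r : R) : 0 < r -> dot (x - y) (x - y) < r ^+ 2 ->
  ball y r x.
Proof.
move=> r0 h; apply/row_ballP; split=> // j.
rewrite -(ltr_pXn2r (n := 2))// ?nnegrE ?(ltW r0)// -normrX ger0_norm ?sqr_ge0//.
apply: le_lt_trans h; apply: le_trans (coord_sqr_le_dot _ j).
by rewrite !mxE -sqrrN opprB.
Qed.

Lemma closed_sqdist_le y (r : R) : closed [set x | dot (x - y) (x - y) <= r].
Proof.
apply: (@preimage_closed _ _ (fun x => dot (x - y) (x - y)) [set t | t <= r]).
  by move=> x _; exact: sqdist_continuous.
exact: closed_le.
Qed.

Lemma compact_sqdist_le A y (r : R) : closed A -> 0 < r ->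
  compact (A `&` [set x | dot (x - y) (x - y) <= r ^+ 2]).
Proof.
move=> cA r0; apply: bounded_closed_compact; last first.
  by apply: closedI => //; exact: closed_sqdist_le.
exists (`|y| + 2 * r); split; first by rewrite num_real.
move=> B hB x [_ hx]; apply: le_trans (ltW hB).
have : ball y (2 * r) x.
  apply: sqdist_ball; first by rewrite mulr_gt0.
  apply: le_lt_trans hx _; rewrite exprMn ltr_pMl ?exprn_gt0//.
  by rewrite -[X in X < _](expr1n R 2) ltr_pXn2r// ?nnegrE// ltr1n.
rewrite -ball_normE/= => /ltW h.
rewrite -[x](subrK y) addrC (le_trans (ler_normD _ _))// lerD2l.
by rewrite distrC.
Qed.

End sqdist.

Section barriers.
Context (R : realType) (n : nat) (Omega : set 'rV[R]_n).
Hypothesis oO : open Omega.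
Variable u : 'rV[R]_n -> R.
Hypothesis hu3 : Ck 3 Omega u.
Variables (f f' F : R -> R).
Hypothesis hf : forall t : R, is_derive t 1 f (f' t).
Hypothesis hFf : forall t : R, is_derive t 1 F (f t).
Hypothesis equ : forall x, Omega x -> mean_curvature_op u x + f (u x) = 0.
Implicit Types (x y z w : 'rV[R]_n).

Lemma jet2_solution z w : Omega z ->
  jet2 u z w (dot w (grad u z)) (frob (hess u z) (rank1 w w)).
Proof.
move=> Oz; apply: (jet2_eq (jet2_C2 oO w (CkW hu3) Oz)) => //.
rewrite frob_rank1 dotC; apply: eq_bigr => i _.
by rewrite (dot_grad_partial oO hu3 w i Oz).
Qed.

Lemma jet2_expR k z w (a b : R) : jet2 k z w a b ->
  jet2 (fun x => expR (k x)) z w (expR (k z) * a)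
    (expR (k z) * a ^+ 2 + expR (k z) * b).
Proof.
move=> jk; have nE : \forall s \near k z, is_derive (s : R) 1 (@expR R) (expR s).
  by apply: filterE => s; exact: is_derive_expR.
exact: (jet2_comp nE (is_derive_expR (k z)) jk).
Qed.

(** For [L] the linearized operator with its drift,
    [L (expR (l * u)) = l * expR (l * u) * (l * q * m ^+ 2 + f u * m)], which is
    positive for large [l] as long as the gradient stays away from zero. *)
Lemma exp_solution_at_max z y (e l d : R) :
  let g := grad u z in let q := dot g g in let m := slope u z in
  Omega z -> g != 0 ->
  (\forall x \near z,
    P_function F u x + (e * expR (l * u x) + - d * dot (x - y) (x - y)) <=
    P_function F u z + (e * expR (l * u z) + - d * dot (z - y) (z - y))) ->
  e * l * expR (l * u z) * (l * q * m ^+ 2 + f (u z) * m) <=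
  2 * d * (n%:R - m ^+ 2 * q + (2 + q) * f (u z) * m / q * dot g (z - y)).
Proof.
move=> g q m Oz gz zmax; set E := expR (l * u z).
have q0 : q != 0 by rewrite dot_eq0.
have m0 : 0 < m := slope_gt0 u z.
have mq : m ^+ 2 * (1 + q) = 1 := slope_sqr u z.
pose dk := (e * l * E) *: g + (- (2 * d)) *: (z - y).
pose K := (e * l * E) *: (l *: rank1 g g + hess u z) + (- (2 * d)) *: 1%:M.
have jk w : jet2 (fun x => e * expR (l * u x) + - d * dot (x - y) (x - y)) z w
    (dot w dk) (frob K (rank1 w w)).
  have j1 := jet2Z e (jet2_expR (jet2Z l (jet2_solution w Oz))).
  have j2 := jet2D j1 (jet2Z (- d) (jet2_sqdist y z w)).
  apply: (jet2_eq j2).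
    by rewrite /dk [in RHS]dotDr !dotZr -/E -/g; ring.
  rewrite /K !frobDl !frobZl !frobDl !frobZl !frob_rank1 mulmx_rank1 dotZl.
  by rewrite mulmx1 (dotC g w) -/E -/g; ring.
have := subsolution_at_max oO hu3 hf hFf equ Oz gz jk zmax.
rewrite -/g -/q -/m.
have eqn : m * \tr (hess u z) - m ^+ 3 * dot (g *m hess u z) g + f (u z) = 0.
  by rewrite -(equ Oz) (mean_curvature_opE oO hu3 Oz).
have trE : \tr (hess u z) = m ^+ 2 * dot (g *m hess u z) g - f (u z) / m.
  apply: (mulfI (lt0r_neq0 m0)); rewrite mulrBr [m * (_ / m)]mulrC divfK ?lt0r_neq0//.
  by apply/eqP; rewrite -subr_eq0 -eqn; apply/eqP; ring.
rewrite /K /dk !mxtraceD !mxtraceZ !mxtraceD !mxtraceZ tr_rank1 mxtrace1 trE.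
rewrite !frobDl !frobZl !frobDl !frobZl !frob_rank1 mulmx_rank1 mulmx1 dotZl.
rewrite [dot g (_ *: g + _)]dotDr !dotZr -/q.
have qE := slope_inv m0 mq.
rewrite -subr_ge0 => h; rewrite -subr_ge0; apply: le_trans h _.
rewrite le_eqVlt; apply/orP; left; apply/eqP.
move: q0; rewrite qE => q0.
move: (dot (g *m hess u z) g) (dot g (z - y)) (f (u z)) => tau gy fu.
field; rewrite lt0r_neq0//=; apply: contraNneq q0 => E0.
have -> : m ^- 2 - 1 = (1 + -1 * m ^+ 2) / m ^+ 2 by field; rewrite lt0r_neq0.
by rewrite E0 mul0r.
Qed.

End barriers.

(** * The maximum principle on unbounded domains *)

Section maximum_estimates.
Context (R : realType).
Implicit Types m q eta C K : R.

(** As [F] is nonpositive, [P >= -1 + eta] forces [m <= 1 - eta]: the gradient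
    is bounded away from zero wherever [P] exceeds [-1] by a fixed amount. *)
Lemma gradient_lower_bound m q eta : 0 < m -> m ^+ 2 * (1 + q) = 1 ->
  0 < eta -> m <= 1 - eta -> 2 * eta <= q.
Proof.
move=> m0 mq eta0 meta; rewrite leNgt; apply/negP => q2.
have e1 : eta < 1 by rewrite -subr_gt0 (lt_le_trans m0).
have m2 : m ^+ 2 <= (1 - eta) ^+ 2.
  by rewrite lerXn2r// ?nnegrE ?subr_ge0 ltW.
have : m ^+ 2 * (1 + q) < m ^+ 2 * (1 + 2 * eta).
  by rewrite ltr_pM2l ?exprn_gt0// ltrD2l.
rewrite mq; apply/negP; rewrite -leNgt.
apply: le_trans (_ : (1 - eta) ^+ 2 * (1 + 2 * eta) <= 1).
  by rewrite ler_wpM2r// addr_ge0// mulr_ge0// ltW.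
rewrite -subr_ge0.
have -> : 1 - (1 - eta) ^+ 2 * (1 + 2 * eta) = eta ^+ 2 * (3 - 2 * eta) by ring.
by rewrite mulr_ge0 ?sqr_ge0// subr_ge0; lra.
Qed.

Lemma slope_lower_bound m q C : m ^+ 2 * (1 + q) = 1 -> 0 <= q -> q <= C ^+ 2 ->
  1 / (1 + C ^+ 2) <= m ^+ 2.
Proof.
move=> mq q0 qC; have C2 : 0 < 1 + C ^+ 2 by rewrite ltr_pwDl ?sqr_ge0.
rewrite ler_pdivrMr//; apply: le_trans (_ : m ^+ 2 * (1 + q) <= _).
  by rewrite mq.
by rewrite ler_wpM2l ?sqr_ge0// lerD2l.
Qed.

Lemma slope_upper_bound (Fu m eta M : R) :
  -1 <= M -> M + eta <= Fu - m -> Fu <= 0 -> m <= 1 - eta.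
Proof. by move=> *; lra. Qed.

Lemma drift_bound (m q eta C K fu gy rho d : R) :
  0 < m -> m <= 1 -> 0 < eta -> 2 * eta <= q -> q <= C ^+ 2 ->
  0 <= C -> `|fu| <= K -> 0 < d -> d ^+ 2 * rho <= 1 -> gy ^+ 2 <= q * rho ->
  d * ((2 + q) * fu * m / q * gy) <= (2 + C ^+ 2) * K / (2 * eta) * C.
Proof.
move=> m0 m1 eta0 q2 qC C0 fK d0 dr gr.
have q0 : 0 < q by apply: lt_le_trans q2; rewrite mulr_gt0.
apply: le_trans (ler_norm _) _.
have -> : d * ((2 + q) * fu * m / q * gy) = ((2 + q) * fu * m / q) * (d * gy).
  by ring.
rewrite normrM; apply: ler_pM => //; last first.
  rewrite -(ler_pXn2r (n := 2))// ?nnegrE// -normrX ger0_norm ?sqr_ge0//.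
  rewrite exprMn; apply: le_trans (_ : d ^+ 2 * (q * rho) <= _).
    by rewrite ler_wpM2l ?sqr_ge0.
  have rho0 : 0 <= rho by rewrite -(pmulr_rge0 _ q0) (le_trans (sqr_ge0 gy)).
  rewrite mulrCA -[leRHS]mulr1 ler_pM ?(ltW q0)// mulr_ge0 ?sqr_ge0//.
have q20 : 0 <= 2 + q by rewrite addr_ge0// ltW.
rewrite !normrM normfV (ger0_norm (ltW m0)) (ger0_norm (ltW q0)).
rewrite (ger0_norm q20).
have K0 : 0 <= K by apply: le_trans fK.
rewrite ler_pM ?invr_ge0 ?(ltW q0) ?lef_pV2 ?posrE ?mulr_gt0//.
  by rewrite mulr_ge0 ?(ltW m0)// mulr_ge0.
apply: le_trans (_ : (2 + q) * `|fu| * 1 <= _).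
  by rewrite ler_wpM2l// mulr_ge0.
by rewrite mulr1 ler_pM// lerD2l.
Qed.

End maximum_estimates.

Section maximum_principle.
Context (R : realType) (n : nat) (Omega : set 'rV[R]_n).
Hypothesis oO : open Omega.
Variable u : 'rV[R]_n -> R.
Hypothesis hu3 : Ck 3 Omega u.
Variables (f f' F : R -> R).
Hypothesis hf : forall t : R, is_derive t 1 f (f' t).
Hypothesis hFf : forall t : R, is_derive t 1 F (f t).
Hypothesis equ : forall x, Omega x -> mean_curvature_op u x + f (u x) = 0.
Variables (G : 'rV[R]_n -> 'rV[R]_n) (C M : R).
Hypothesis cu : {within closure Omega, continuous u}.
Hypothesis cG : {within closure Omega, continuous G}.
Hypothesis GE : forall x, Omega x -> G x = grad u x.
Hypothesis u_gt0 : forall x, Omega x -> 0 < u x.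
Hypothesis u_bd0 : forall p, boundary Omega p -> u p = 0.
Hypothesis huC : forall x, Omega x -> u x <= C.
Hypothesis hgC : forall x, Omega x -> enorm (grad u x) <= C.
Hypothesis hF0 : forall t : R, F t <= 0.
Hypothesis M_geN1 : -1 <= M.
Hypothesis bdM : forall p, boundary Omega p ->
  F (u p) - isqrt1 (dot (G p) (G p)) <= M.
Implicit Types (x y z w : 'rV[R]_n).

Lemma source_bounded : exists2 K : R, 0 <= K &
  forall t : R, 0 <= t <= C -> `|f t| <= K.
Proof.
have [C0|C0] := leP 0 C; last first.
  by exists 0 => // t /andP[t0 tC]; move: (le_lt_trans (le_trans t0 tC) C0); rewrite ltxx.
have cf : {within `[0, C], continuous (fun t : R => `|f t|)}.
  apply: continuous_subspaceT => t; apply: cvg_norm.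
  exact: is_derive_continuous (hf t).
have [c _ hc] := @EVT_max R (fun t => `|f t|) 0 C C0 cf.
by exists `|f c| => // t tC; apply: hc; rewrite in_itv.
Qed.

(** [G] extends the gradient to the closure, so this is defined and continuous
    up to the boundary. The quadratic term makes the maximum exist when [Omega]
    is unbounded. *)
Definition penalized (e l d : R) y x : R :=
  F (u x) - isqrt1 (dot (G x) (G x))
  + (e * expR (l * u x) + - d * dot (x - y) (x - y)).

Lemma penalized_continuous e l d y :
  {within closure Omega, continuous (penalized e l d y)}.
Proof.
apply/subspace_continuousP => x cx.
have /subspace_continuousP/(_ x cx) ux := cu.
have /subspace_continuousP/(_ x cx) Gx := cG.
have c1 : F \o u @ within (closure Omega) (nbhs x) --> F (u x).
  by apply: (continuous_cvg _ _ ux); exact: is_derive_continuous (hFf (u x)).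
have dG : (fun z => dot (G z) (G z)) @ within (closure Omega) (nbhs x)
    --> dot (G x) (G x).
  exact: (@dot_cvg R n _ _ _ G G _ _ Gx Gx).
have c2 : @isqrt1 R \o (fun z => dot (G z) (G z)) @ within (closure Omega) (nbhs x)
    --> isqrt1 (dot (G x) (G x)).
  apply: (continuous_cvg _ _ dG).
  exact: is_derive_continuous (is_derive_isqrt1 (dot_gtN1 (G x))).
have c3 : @expR R \o (fun z => l * u z) @ within (closure Omega) (nbhs x)
    --> expR (l * u x).
  have c : (fun z => l * u z) @ within (closure Omega) (nbhs x) --> l * u x.
    exact: (cvgM (cvg_cst l) ux).
  by apply: (continuous_cvg _ _ c); exact: continuous_expR.
have c4 : (fun z => dot (z - y) (z - y)) @ within (closure Omega) (nbhs x)
    --> dot (x - y) (x - y).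
  by apply: cvg_within_filter; exact: sqdist_continuous.
exact: (cvgD (cvgB c1 c2) (cvgD (cvgM (cvg_cst e) c3) (cvgM (cvg_cst (- d)) c4))).
Qed.

Lemma penalizedE e l d y x : Omega x -> penalized e l d y x =
  P_function F u x + (e * expR (l * u x) + - d * dot (x - y) (x - y)).
Proof. by move=> Ox; rewrite /penalized GE// P_functionE. Qed.

Lemma interior_or_boundary x : closure Omega x -> Omega x \/ boundary Omega x.
Proof.
move=> cx; have [Ox|nOx] := pselect (Omega x); [by left|right].
by split=> // /interior_subset.
Qed.

Lemma P_le0 x : P_function F u x <= 0.
Proof. by rewrite P_functionE subr_le0 (le_trans (hF0 _))// ltW// slope_gt0. Qed.

Lemma grad_sqr_bound x : Omega x -> dot (grad u x) (grad u x) <= C ^+ 2.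
Proof.
move=> Ox; rewrite -enorm_sqr lerXn2r// ?nnegrE ?sqrtr_ge0 ?hgC//.
exact: le_trans (sqrtr_ge0 _) (hgC Ox).
Qed.

(** Outside the ball where [d^2 |x - y|^2 <= 2] the penalty outweighs what [P]
    and the exponential can contribute, and on the boundary [P] is at most [M],
    while the value at [y] is at least [M + 2 * eta]. *)
Lemma penalized_max (eta e l d : R) y : Omega y ->
  P_function F u y = M + 2 * eta -> 0 < eta -> eta <= 1 -> 0 < e -> e <= eta ->
  (forall x, Omega x -> e * expR (l * u x) <= eta) -> 0 < d ->
  exists2 z, Omega z & [/\ M + eta <= P_function F u z,
    d ^+ 2 * dot (z - y) (z - y) <= 1 &
    \forall x \near z,
      P_function F u x + (e * expR (l * u x) + - d ^+ 2 * dot (x - y) (x - y))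
      <= P_function F u z
         + (e * expR (l * u z) + - d ^+ 2 * dot (z - y) (z - y))].
Proof.
move=> Oy Py eta0 eta1 e0 e_eta exp_eta d0.
pose Q := penalized e l (d ^+ 2) y.
have d20 : 0 < d ^+ 2 by rewrite exprn_gt0.
have Qy : M + 2 * eta <= Q y.
  by rewrite /Q penalizedE// Py subrr dot0l mulr0 addr0 lerDl mulr_ge0 ?expR_ge0// ltW.
pose r := Num.sqrt 2 / d.
have r0 : 0 < r by rewrite divr_gt0// sqrtr_gt0.
have r2 : r ^+ 2 = 2 / d ^+ 2 by rewrite /r expr_div_n sqr_sqrtr.
pose K := closure Omega `&` [set x | dot (x - y) (x - y) <= r ^+ 2].
have cK : compact K by apply: compact_sqdist_le r0; exact: closed_closure.
have Ky : K y.
  by split; [exact: subset_closure|rewrite /= subrr dot0l sqr_ge0].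
have cQ : {within K, continuous Q}.
  have KO : K `<=` closure Omega by move=> x [].
  exact: (continuous_subspaceW KO (@penalized_continuous e l (d ^+ 2) y)).
have [z zK zmax] := EVT_max_rV (ex_intro _ y Ky) cK cQ.
move: zK; rewrite inE => -[cz _].
have Qzy : Q y <= Q z by apply: zmax; rewrite inE.
have far x : Omega x -> Q x <= Q z.
  move=> Ox; have [Kx|nKx] := pselect (K x); first by apply: zmax; rewrite inE.
  have hx : 2 < d ^+ 2 * dot (x - y) (x - y).
    rewrite ltNge; apply/negP => hx; apply: nKx; split.
      exact: subset_closure.
    by rewrite /= r2 ler_pdivlMr// mulrC.
  apply: le_trans Qzy; apply: le_trans Qy; rewrite /Q penalizedE// mulNr.
  have := exp_eta x Ox; have := P_le0 x.
  move: (P_function _ _ _) (e * _) (d ^+ 2 * _) hx M_geN1 eta0.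
  by move=> a b c *; lra.
have Oz : Omega z.
  have [//|bz] := interior_or_boundary cz.
  have := le_trans Qy Qzy; rewrite /Q /penalized (u_bd0 bz) mulr0 expR0 mulr1.
  have := bdM bz; rewrite (u_bd0 bz).
  have : 0 <= d ^+ 2 * dot (z - y) (z - y) by rewrite mulr_ge0 ?sqr_ge0 ?dot_ge0.
  rewrite mulNr; move: (F 0 - _) (d ^+ 2 * _) e_eta eta0 => a b.
  by move=> *; exfalso; lra.
have nO : \forall x \near z, Omega x by exact: open_nbhs_nbhs.
exists z => //; split; last first.
- have le_eq (a b a' b' : R) : a = a' -> b = b' -> a <= b -> a' <= b'.
    by move=> <- <-.
  apply: filterS nO => x Ox.
  exact: (le_eq _ _ _ _ (penalizedE e l _ y Ox) (penalizedE e l _ y Oz)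
    (far x Ox)).
all: have := le_trans Qy Qzy; rewrite /Q penalizedE// mulNr.
all: have := exp_eta z Oz; have := P_le0 z.
all: have : 0 <= d ^+ 2 * dot (z - y) (z - y)
  by rewrite mulr_ge0 ?sqr_ge0 ?dot_ge0.
all: have : 0 <= e * expR (l * u z) by rewrite mulr_ge0 ?expR_ge0// ltW.
all: move: (P_function F u z) (e * expR _) (d ^+ 2 * dot _ _) M_geN1 eta0 eta1.
all: by move=> a b c *; lra.
Qed.

(** If [P] exceeded [M] at [y], the penalized function centred at [y] would have
    an interior maximum, where the exponential term is a strict subsolution by
    a margin [e * l] while the penalty costs only [O(d)]. *)
Lemma P_le_bound y : Omega y -> P_function F u y <= M.
Proof.
move=> Oy; rewrite leNgt; apply/negP => PM.
pose eta := (P_function F u y - M) / 2.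
have eta0 : 0 < eta by rewrite divr_gt0// subr_gt0.
have Py : P_function F u y = M + 2 * eta by rewrite /eta mulrC divfK// addrC subrK.
have eta1 : eta <= 1.
  have aux (a b : R) : -1 <= a -> a + 2 * b <= 0 -> b <= 1 by move=> *; lra.
  by apply: aux M_geN1 _; rewrite -Py P_le0.
have C0 : 0 < C by apply: lt_le_trans (huC Oy); exact: u_gt0.
have [K K0 hK] := source_bounded.
(* This [l] makes the bracket in [exp_solution_at_max] at least [1]. *)
pose l := (K + 1) * (1 + C ^+ 2) / (2 * eta).
have C21 : 0 < 1 + C ^+ 2 by rewrite ltr_pwDl ?sqr_ge0.
have K1 : 0 < K + 1 by rewrite ltr_wpDl.
have l0 : 0 < l by rewrite /l divr_gt0// mulr_gt0.
pose e := eta * expR (- (l * C)).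
have e0 : 0 < e by rewrite mulr_gt0 ?expR_gt0.
have e_eta : e <= eta.
  by rewrite ler_piMr ?(ltW eta0)// -expR0 ler_expR oppr_le0 mulr_ge0// ltW.
have exp_eta z : Omega z -> e * expR (l * u z) <= eta.
  move=> Oz; rewrite /e -mulrA -expRD ler_piMr ?(ltW eta0)// -expR0 ler_expR.
  by rewrite addrC subr_le0 ler_wpM2l ?(ltW l0)// huC.
pose B := (2 + C ^+ 2) * K / (2 * eta) * C.
have B0 : 0 <= B.
  have C2 : 0 <= 2 + C ^+ 2 by rewrite addr_ge0 ?sqr_ge0.
  have eta2 : 0 <= 2 * eta by rewrite mulr_ge0// ltW.
  exact: mulr_ge0 (divr_ge0 (mulr_ge0 C2 K0) eta2) (ltW C0).
(* [d * D] bounds the cost of the penalty; the summand [1] makes it strict. *)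
pose D := 2 * n%:R + 2 * B + 1.
have D0 : 0 < D.
  exact: ltr_wpDl (addr_ge0 (mulr_ge0 (ler0n R 2) (ler0n R n))
    (mulr_ge0 (ler0n R 2) B0)) ltr01.
pose d := Num.min 1 (e * l / D).
have d0 : 0 < d by rewrite lt_min ltr01 divr_gt0// mulr_gt0.
have d1 : d <= 1 by rewrite ge_min lexx.
have dD : d * D <= e * l by rewrite -ler_pdivlMr// ge_min lexx orbT.
have [z Oz [Pz dz zmax]] := penalized_max Oy Py eta0 eta1 e0 e_eta exp_eta d0.
set g := grad u z; set q := dot g g; set m := slope u z.
have m0 : 0 < m := slope_gt0 u z.
have mq : m ^+ 2 * (1 + q) = 1 := slope_sqr u z.
have m_eta : m <= 1 - eta.
  by apply: slope_upper_bound M_geN1 _ (hF0 (u z)); rewrite -P_functionE.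
have q2 := gradient_lower_bound m0 mq eta0 m_eta.
have q0 : 0 < q by apply: lt_le_trans q2; rewrite mulr_gt0.
have qC : q <= C ^+ 2 := grad_sqr_bound Oz.
have gz : g != 0 by rewrite -dot_gt0.
have fK : `|f (u z)| <= K by apply: hK; rewrite ltW ?u_gt0 ?huC.
have m1 : m <= 1 by apply: le_trans m_eta _; rewrite gerBl ltW.
have := exp_solution_at_max oO hu3 hf hFf equ Oz gz zmax.
rewrite -/g -/q -/m; apply/negP; rewrite -ltNge.
set gy := dot g (z - y).
have gr : gy ^+ 2 <= q * dot (z - y) (z - y) := cauchy_schwarz g (z - y).
have hB := drift_bound m0 m1 eta0 q2 qC (ltW C0) fK d0 dz gr.
rewrite -/B in hB.
have L : e * l <= e * l * expR (l * u z) * (l * q * m ^+ 2 + f (u z) * m).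
  have el0 : 0 < e * l by rewrite mulr_gt0.
  rewrite -mulrA ler_peMr ?(ltW el0)//.
  apply: mulr_ege1; first by rewrite -expR0 ler_expR mulr_ge0 ?ltW ?u_gt0.
  have lq : K + 1 <= l * q * m ^+ 2.
    have -> : K + 1 = l * (2 * eta) * (1 / (1 + C ^+ 2)).
      by rewrite /l; field; rewrite !lt0r_neq0.
    have a1 := mulr_ge0 (ltW l0) (mulr_ge0 (ler0n R 2) (ltW eta0)).
    have a2 := divr_ge0 ler01 (ltW C21).
    apply: ler_pM a1 a2 _ (slope_lower_bound mq (ltW q0) qC).
    by rewrite ler_pM2l.
  have fm : - K <= f (u z) * m.
    have : `|f (u z) * m| <= K.
      by rewrite normrM (ger0_norm (ltW m0)) -[leRHS]mulr1 ler_pM// ltW.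
    by rewrite ler_norml => /andP[].
  by rewrite -(addrK K 1) [1 + K]addrC lerD.
apply: lt_le_trans L; apply: lt_le_trans dD.
have nm : n%:R - m ^+ 2 * q <= n%:R by rewrite gerBl mulr_ge0 ?sqr_ge0 ?ltW.
have -> : 2 * d ^+ 2 * (n%:R - m ^+ 2 * q + (2 + q) * f (u z) * m / q * gy)
   = d * (2 * (d * (n%:R - m ^+ 2 * q))
        + 2 * (d * ((2 + q) * f (u z) * m / q * gy))) by ring.
rewrite ltr_pM2l// /D.
have dn : d * (n%:R - m ^+ 2 * q) <= n%:R.
  apply: le_trans (_ : d * n%:R <= _); first by rewrite ler_pM2l.
  by rewrite ler_piMl.
apply: le_lt_trans (_ : 2 * n%:R + 2 * B < _); last by rewrite ltrDl.
by rewrite lerD// ler_pM2l.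
Qed.

End maximum_principle.

(** * The strong maximum principle *)

Lemma le_sqr1p (R : realDomainType) (a : R) : 0 <= a -> a <= (1 + a) ^+ 2.
Proof.
move=> a0; rewrite -subr_ge0 (_ : _ - a = 1 + a + a ^+ 2); last by ring.
by rewrite addr_ge0 ?sqr_ge0// addr_ge0.
Qed.

Lemma lt_sub_half (R : realFieldType) (a b : R) : a < b -> a < b - (b - a) / 2.
Proof. by move=> ab; lra. Qed.

Section strong_maximum_principle.
Context (R : realType) (n : nat) (Omega : set 'rV[R]_n).
Hypothesis oO : open Omega.
Variable u : 'rV[R]_n -> R.
Hypothesis hu3 : Ck 3 Omega u.
Variables (f f' F : R -> R).
Hypothesis hf : forall t : R, is_derive t 1 f (f' t).
Hypothesis hFf : forall t : R, is_derive t 1 F (f t).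
Hypothesis equ : forall x, Omega x -> mean_curvature_op u x + f (u x) = 0.
Variables (C M : R).
Hypothesis u_gt0 : forall x, Omega x -> 0 < u x.
Hypothesis huC : forall x, Omega x -> u x <= C.
Hypothesis hgC : forall x, Omega x -> enorm (grad u x) <= C.
Hypothesis P_le : forall x, Omega x -> P_function F u x <= M.
Implicit Types (x y z w : 'rV[R]_n).

(** The computation for Hopf's barrier: [expR (- al * |x - y|^2)] is a strict
    subsolution away from [y] when [al] is large. *)
Lemma exp_sqdist_at_max z y (e al : R) :
  let g := grad u z in let q := dot g g in let m := slope u z in
  Omega z -> g != 0 -> 0 < e -> 0 < al ->
  (\forall x \near z,
    P_function F u x + e * expR (- al * dot (x - y) (x - y)) <=
    P_function F u z + e * expR (- al * dot (z - y) (z - y))) ->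
  2 * al * (dot (z - y) (z - y) - m ^+ 2 * dot g (z - y) ^+ 2) <=
  n%:R - m ^+ 2 * q + (2 + q) * f (u z) * m / q * dot g (z - y).
Proof.
move=> g q m Oz gz e0 al0 zmax.
set E := expR (- al * dot (z - y) (z - y)).
pose rho := z - y.
pose dk := (- (2 * al * e * E)) *: rho.
pose K := (e * E) *: ((4 * al ^+ 2) *: rank1 rho rho + (- (2 * al)) *: 1%:M).
have jk w : jet2 (fun x => e * expR (- al * dot (x - y) (x - y))) z w
    (dot w dk) (frob K (rank1 w w)).
  have j1 := jet2Z e (jet2_expR (jet2Z (- al) (jet2_sqdist y z w))).
  apply: (jet2_eq j1).
    by rewrite /dk dotZr -/E -/rho; ring.
  rewrite /K !frobZl !frobDl !frobZl !frob_rank1 mulmx_rank1 dotZl.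
  by rewrite mulmx1 (dotC rho w) -/E -/rho; ring.
have := subsolution_at_max oO hu3 hf hFf equ Oz gz jk zmax.
rewrite -/g -/q -/m /K /dk !mxtraceZ !mxtraceD !mxtraceZ tr_rank1 mxtrace1.
rewrite !frobZl !frobDl !frobZl !frob_rank1 mulmx_rank1 mulmx1 dotZl !dotZr.
rewrite -/q -/rho (dotC rho g).
have c0 : 0 < 2 * al * e * E by rewrite !mulr_gt0// expR_gt0.
move=> h; rewrite -subr_le0 -(pmulr_rle0 _ c0); apply: le_trans h.
rewrite le_eqVlt; apply/orP; left; apply/eqP; ring.
Qed.

Lemma grad_sqr_continuous x : Omega x ->
  {for x, continuous (fun y => dot (grad u y) (grad u y))}.
Proof.
move=> Ox.
have cp i : (fun y => partial i u y) @ x --> partial i u x.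
  exact: (Ck_continuous (Ck_partial i hu3) Ox).
have qE y : dot (grad u y) (grad u y) = \sum_i partial i u y * partial i u y.
  by apply: eq_bigr => i _; rewrite mxE.
rewrite (_ : (fun y => _) = (fun y => \sum_i partial i u y * partial i u y));
  last exact/funext.
exact: (@cvg_sumE R n _ (nbhs x) _ (fun i y => partial i u y * partial i u y)
    _ (fun i => cvgM (cp i) (cp i))).
Qed.

Lemma P_continuous x : Omega x -> {for x, continuous (P_function F u)}.
Proof.
move=> Ox.
have cu : u @ x --> u x := Ck_continuous hu3 Ox.
have cq : (fun y => dot (grad u y) (grad u y)) @ x
    --> dot (grad u x) (grad u x) := grad_sqr_continuous Ox.
have cF : F \o u @ x --> F (u x).
  by apply: (continuous_cvg _ _ cu); exact: is_derive_continuous (hFf (u x)).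
have cs : @isqrt1 R \o (fun y => dot (grad u y) (grad u y)) @ x --> slope u x.
  apply: (continuous_cvg _ _ cq).
  exact: is_derive_continuous (is_derive_isqrt1 (dot_gtN1 (grad u x))).
have -> : P_function F u = (fun y => F (u y) - slope u y).
  by apply/funext => y; exact: P_functionE.
exact: (cvgB cF cs).
Qed.

(** The barrier is used on the annulus between a ball around [y] where [P] stays
    below [M] and the sphere of radius [2 |x0 - y|], inside which [x0] lies. As
    the barrier is smaller on the outer sphere than at [x0], a maximum of [P]
    plus the barrier lies inside the annulus. *)
Lemma no_interior_touching x0 y (r1 q0 : R) :
  let s2 := dot (x0 - y) (x0 - y) in
  (forall x, dot (x - y) (x - y) <= 4 * s2 ->
     Omega x /\ q0 <= dot (grad u x) (grad u x)) ->
  0 < q0 -> 0 < r1 -> P_function F u x0 = M ->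
  (exists2 eta : R, 0 < eta & forall x, dot (x - y) (x - y) < r1 ^+ 2 ->
     Omega x -> P_function F u x <= M - eta) ->
  False.
Proof.
move=> s2 hball q00 r10 Px0 [eta eta0 hin].
have Ox0 : Omega x0.
  by apply: (hball x0 _).1; rewrite ler_peMl ?dot_ge0// ler1n.
have s20 : 0 < s2.
  rewrite dot_gt0 subr_eq0; apply/eqP => x0y.
  have := hin x0; rewrite x0y subrr dot0l exprn_gt0// => /(_ isT).
  rewrite -x0y Px0 => /(_ Ox0); rewrite lerBrDl gerDr leNgt eta0//.
pose s := Num.sqrt s2; have s0 : 0 < s by rewrite sqrtr_gt0.
have ss : s ^+ 2 = s2 by rewrite sqr_sqrtr// ltW.
have [K K0 hK] := source_bounded hf C.
have C0 : 0 < C by apply: lt_le_trans (huC Ox0); exact: u_gt0.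
have C21 : 0 < 1 + C ^+ 2 by rewrite ltr_pwDl ?sqr_ge0.
pose B := (2 + C ^+ 2) * K / (2 * (q0 / 2)) * C.
have B0 : 0 <= B.
  have C2 : 0 <= 2 + C ^+ 2 by rewrite addr_ge0 ?sqr_ge0.
  have q2 : 0 <= 2 * (q0 / 2) by rewrite mulr_ge0// divr_ge0// ltW.
  exact: mulr_ge0 (divr_ge0 (mulr_ge0 C2 K0) q2) (ltW C0).
have D0 : 0 < n%:R + 2 * s * B + 1 :> R.
  exact: ltr_wpDl (addr_ge0 (ler0n R n)
    (mulr_ge0 (mulr_ge0 (ler0n R 2) (ltW s0)) B0)) ltr01.
pose al := (n%:R + 2 * s * B + 1) * (1 + C ^+ 2) / (2 * r1 ^+ 2).
have al0 : 0 < al.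
  by apply: divr_gt0; apply: mulr_gt0 => //; rewrite exprn_gt0.
pose k x := eta * expR (- al * dot (x - y) (x - y)).
have kle x : k x <= eta.
  rewrite /k ler_piMr ?(ltW eta0)// -expR0 ler_expR mulNr oppr_le0.
  by rewrite mulr_ge0 ?dot_ge0// ltW.
have k_gt0 x : 0 < k x by rewrite mulr_gt0 ?expR_gt0.
pose A := [set x : 'rV[R]_n | dot (x - y) (x - y) <= (2 * s) ^+ 2].
have AE x : A x <-> dot (x - y) (x - y) <= 4 * s2.
  have -> : 4 * s2 = (2 * s) ^+ 2 by rewrite exprMn ss; ring.
  by [].
have cA : compact A.
  have := @compact_sqdist_le R n setT y (2 * s) closedT.
  by rewrite setTI; apply; rewrite mulr_gt0.
have Ax0 : A x0 by apply/AE; rewrite ler_peMl ?dot_ge0// ler1n.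
have cQ : {within A, continuous (fun x => P_function F u x + k x)}.
  apply/subspace_continuousP => x /AE/hball[Ox _].
  apply: cvg_within_filter; apply: cvgD; first exact: (P_continuous Ox).
  have c1 : (fun x => - al * dot (x - y) (x - y)) @ x -->
      - al * dot (x - y) (x - y).
    have c2 := @sqdist_continuous R n y x.
    exact: (cvgM (cvg_cst (- al)) c2).
  have c3 : @expR R \o (fun x => - al * dot (x - y) (x - y)) @ x -->
      expR (- al * dot (x - y) (x - y)).
    by apply: (continuous_cvg _ _ c1); exact: continuous_expR.
  exact: (cvgM (cvg_cst eta) c3).
have [z zA zmax] := EVT_max_rV (ex_intro _ x0 Ax0) cA cQ.
move: zA; rewrite inE => Az.
have [Oz qz] := hball z ((AE z).1 Az).
have Qz : M + k x0 <= P_function F u z + k z.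
  by rewrite -Px0; apply: zmax; rewrite inE.
have outer : dot (z - y) (z - y) < 4 * s2.
  rewrite lt_neqAle ((AE z).1 Az) andbT; apply/eqP => zs.
  have : k z < k x0.
    rewrite /k ltr_pM2l// ltr_expR !mulNr ltrN2 ltr_pM2l// zs -/s2.
    by rewrite ltr_pMl// ltr1n.
  by have := lerD (P_le Oz) (lexx (k z)); move=> /(le_trans Qz);
    rewrite lerD2l leNgt => /negP.
have inner : r1 ^+ 2 <= dot (z - y) (z - y).
  rewrite leNgt; apply/negP => zr.
  have := lerD (hin z zr Oz) (kle z); rewrite subrK => /(le_trans Qz).
  by rewrite gerDl leNgt k_gt0.
have zloc : \forall x \near z, P_function F u x + k x <=
    P_function F u z + k z.
  have : \forall x \near z, dot (x - y) (x - y) < 4 * s2.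
    by apply: (cvgr_lt _ (@sqdist_continuous R n y z)).
  by apply: filterS => x xs; apply: zmax; rewrite inE; apply/AE/ltW.
set g := grad u z in qz; set q := dot g g in qz; set m := slope u z.
have q_gt0 : 0 < q by apply: lt_le_trans qz.
have gz : g != 0 by rewrite -dot_gt0.
have := exp_sqdist_at_max Oz gz eta0 al0 zloc.
apply/negP; rewrite -ltNge -/g -/q -/m.
have m0 : 0 < m := slope_gt0 u z.
have mq : m ^+ 2 * (1 + q) = 1 := slope_sqr u z.
have qC : q <= C ^+ 2 := grad_sqr_bound hgC Oz.
have m1 : m <= 1.
  rewrite -(ler_pXn2r (n := 2))// ?nnegrE ?(ltW m0)// expr1n -mq.
  by rewrite ler_peMr ?sqr_ge0// lerDl ltW.
have gr := cauchy_schwarz g (z - y); rewrite -/q in gr.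
set rho := dot (z - y) (z - y) in outer inner gr *.
set gy := dot g (z - y) in gr *.
have fK : `|f (u z)| <= K by apply: hK; rewrite ltW ?u_gt0 ?huC.
have q02 : 0 < q0 / 2 by rewrite divr_gt0.
have q22 : 2 * (q0 / 2) <= q by rewrite mulrC divfK.
have s2inv : 0 < (2 * s)^-1 by rewrite invr_gt0 mulr_gt0.
have dr : (2 * s)^-1 ^+ 2 * rho <= 1.
  rewrite exprVn mulrC ler_pdivrMr ?exprn_gt0 ?mulr_gt0// mul1r exprMn ss.
  by rewrite ltW//; move: outer; rewrite (_ : 4 = 2 ^+ 2 :> R)//; ring.
have hB := drift_bound m0 m1 q02 q22 qC (ltW C0) fK s2inv dr gr.
rewrite -/B mulrC ler_pdivrMr ?mulr_gt0// in hB.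
have lower : n%:R + 2 * s * B + 1 <= 2 * al * (rho - m ^+ 2 * gy ^+ 2).
  have -> : n%:R + 2 * s * B + 1 = 2 * al * (r1 ^+ 2 * (1 / (1 + C ^+ 2))).
    by rewrite /al; field; rewrite !lt0r_neq0// exprn_gt0.
  have al2 : 0 < 2 * al by rewrite mulr_gt0.
  rewrite (ler_pM2l al2).
  have h1 : r1 ^+ 2 * (1 / (1 + C ^+ 2)) <= rho * m ^+ 2.
    apply: ler_pM (sqr_ge0 _) (divr_ge0 ler01 (ltW C21)) inner _.
    exact: slope_lower_bound mq (ltW q_gt0) qC.
  apply: le_trans h1 _.
  rewrite lerBrDr -lerBrDl -[X in X - _]mulr1 -mq [rho * m ^+ 2]mulrC.
  have -> : rho * (m ^+ 2 * (1 + q)) - m ^+ 2 * rho = m ^+ 2 * (q * rho) by ring.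
  by rewrite ler_wpM2l ?sqr_ge0.
apply: lt_le_trans lower.
apply: le_lt_trans (_ : n%:R + 2 * s * B < _); last by rewrite ltrDl.
apply: lerD; first by rewrite gerBl mulr_ge0 ?sqr_ge0 ?ltW.
by rewrite [leRHS]mulrC.
Qed.

(** Strong maximum principle: a point [y] near [x0] with [P y < M] would be a
    centre for the barrier of [no_interior_touching]. *)
Lemma P_max_open x0 : Omega x0 -> grad u x0 != 0 -> P_function F u x0 = M ->
  \forall y \near x0, P_function F u y = M.
Proof.
move=> Ox0 g0 Px0; set q0 := dot (grad u x0) (grad u x0) / 2.
have q00 : 0 < q0 by rewrite divr_gt0// dot_gt0.
have q0lt : q0 < dot (grad u x0) (grad u x0).
  by rewrite /q0 ltr_pdivrMr// ltr_pMr ?dot_gt0// ltr1n.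
have nW : \forall x \near x0, Omega x /\ q0 < dot (grad u x) (grad u x).
  apply: filterI; first exact: open_nbhs_nbhs.
  exact: (cvgr_gt _ (grad_sqr_continuous Ox0) _ q0lt).
have /nbhs_ballP[rho /= rho0 hrho] := nW.
pose N : R := 3 * (1 + n%:R).
have N0 : 0 < N by rewrite mulr_gt0// ltr_wpDr.
pose r := rho / N.
have r0 : 0 < r by rewrite divr_gt0.
have nb : \forall y \near x0, ball x0 r y by exact: nbhsx_ballx.
apply: filterS nb => y yb.
have s2r : dot (x0 - y) (x0 - y) <= (rho / 3) ^+ 2.
  have -> : rho / 3 = r * (1 + n%:R).
    by rewrite /r /N; field; rewrite lt0r_neq0// ltr_wpDr.
  apply: le_trans (_ : \sum_(i < n) r ^+ 2 <= _).
    apply: ler_sum => i _; move/row_ballP: yb => [_ /(_ i) yi].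
    rewrite -expr2 !mxE -(@real_normK _ (x0 0 i - y 0 i)) ?num_real//.
    by rewrite lerXn2r// ?nnegrE ltW.
  rewrite sumr_const card_ord [leRHS]exprMn -[leLHS]mulr_natr ler_wpM2l ?sqr_ge0//.
  exact: le_sqr1p.
have r_rho : r <= rho / 3.
  rewrite /r /N invfM mulrA ler_piMr ?divr_ge0 ?(ltW rho0)//.
  by rewrite invf_le1 ?ltr_wpDr// lerDl.
have Oy : Omega y.
  apply: (hrho _ _).1; move/row_ballP: yb => [_ yi]; apply/row_ballP; split=> //.
  move=> j; apply: lt_le_trans (yi j) _; apply: le_trans r_rho _.
  by rewrite ler_piMr ?(ltW rho0)// invf_le1// ler1n.
apply/eqP/negPn/negP => Py.
have PyM : P_function F u y < M by rewrite lt_neqAle Py P_le.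
pose eta := (M - P_function F u y) / 2.
have eta0 : 0 < eta by rewrite divr_gt0// subr_gt0.
have : \forall x \near y, P_function F u x < M - eta.
  apply: (cvgr_lt _ (P_continuous Oy)).
  exact: lt_sub_half.
move=> /nbhs_ballP[r1 /= r10 hr1].
apply: (@no_interior_touching x0 y r1 q0) => //; last first.
  by exists eta => // x xr _; apply/ltW/hr1; exact: sqdist_ball.
move=> x xs; have [] := hrho x; last by move=> Ox qx; rewrite ltW.
apply/row_ballP; split=> // j; move/row_ballP: yb => [_ /(_ j) yj].
have xyj : `|y 0 j - x 0 j| <= 2 * (rho / 3).
  have h3 : 0 <= 2 * (rho / 3) by rewrite mulr_ge0// divr_ge0// ltW.
  rewrite -(ler_pXn2r (n := 2))// ?nnegrE// real_normK ?num_real//.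
  have := le_trans (coord_sqr_le_dot (x - y) j) xs.
  rewrite !mxE -sqrrN opprB => /le_trans; apply.
  by rewrite exprMn (_ : 2 ^+ 2 = 4 :> R) ?ler_pM2l//; ring.
rewrite -(subrK (y 0 j) (x0 0 j)) -addrA; apply: le_lt_trans (ler_normD _ _) _.
have -> : rho = rho / 3 + 2 * (rho / 3) by field.
by apply: ltr_leD xyj; apply: lt_le_trans yj _.
Qed.

End strong_maximum_principle.

(** * Unique continuation and flat solutions *)

Section connectedness.
Context (R : realType) (n : nat) (Omega : set 'rV[R]_n).
Hypothesis oO : open Omega.
Hypothesis cO : connected Omega.
Implicit Types (x y z w : 'rV[R]_n).

Lemma connected_propagation (S : 'rV[R]_n -> Prop) x0 :
  Omega x0 -> S x0 ->
  (forall x, Omega x -> S x -> \forall y \near x, S y) ->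
  (forall x, Omega x -> ~ S x -> \forall y \near x, ~ S y) ->
  forall x, Omega x -> S x.
Proof.
move=> Ox0 Sx0 oS oN; suff E : Omega `&` S = Omega.
  by move=> x; rewrite -{1}E => -[].
apply: cO.
- by exists x0.
- exists (interior S); first exact: open_interior.
  apply/seteqP; split=> x [Ox Sx]; split=> //; first exact: oS.
  exact: (@interior_subset _ S).
- exists (~` interior (~` S)); first exact/open_closedC/open_interior.
  apply/seteqP; split=> x [Ox Sx]; split=> //.
    by move=> /(@interior_subset _ (~` S)).
  by apply: contrapT => nS; apply: Sx; exact: oN.
Qed.

Lemma locally_constant (T : Type) (g : 'rV[R]_n -> T) :
  (forall x, Omega x -> \forall y \near x, g y = g x) ->
  forall x y, Omega x -> Omega y -> g y = g x.
Proof.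
move=> hg x y Ox; apply: (connected_propagation (S := fun z => g z = g x) Ox) => //.
  by move=> z Oz gz; apply: filterS (hg z Oz) => w ->.
by move=> z Oz gz; apply: filterS (hg z Oz) => w ->.
Qed.

Lemma near_segment x : Omega x ->
  \forall y \near x, forall t : R, 0 <= t <= 1 -> Omega (x + t *: (y - x)).
Proof.
move=> Ox; have [r r0 rO] := open_ball_sub oO Ox.
have nb : \forall y \near x, ball x r y by exact: nbhsx_ballx.
apply: filterS nb => y /row_ballP[_ yb] t /andP[t0 t1].
apply: rO; apply/row_ballP; split=> // j; rewrite !mxE.
have -> : x 0 j - (x 0 j + t * (y 0 j - x 0 j)) = t * (x 0 j - y 0 j) by ring.
rewrite normrM (ger0_norm t0); apply: le_lt_trans (yb j).
by rewrite ler_piMl.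
Qed.

End connectedness.

Section unique_continuation.
Context (R : realType) (n : nat) (Omega : set 'rV[R]_n).
Hypothesis oO : open Omega.
Hypothesis cO : connected Omega.
Implicit Types (x y z w : 'rV[R]_n).

(** [phi^2] times a decreasing exponential is nonincreasing. *)
Lemma gronwall_zero (phi dphi : R -> R) (L : R) : 0 <= L ->
  (forall t : R, 0 <= t <= 1 -> is_derive t 1 phi (dphi t)) ->
  (forall t : R, 0 <= t <= 1 -> dphi t ^+ 2 <= L ^+ 2 * phi t ^+ 2) ->
  phi 0 = 0 -> phi 1 = 0.
Proof.
move=> L0 dp le phi0.
pose E (t : R) := expR (0 + t * (- (2 * L))).
have dE (t : R) : is_derive t 1 E (E t * - (2 * L)).
  have h := is_derive_affine 0 (- (2 * L)) t.
  exact: (@is_derive1_comp _ (@expR R) _ _ _ _ (is_derive_expR _) h).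
have d3 (s : R) : 0 <= s <= 1 -> is_derive s 1 (fun t => phi t * phi t * E t)
    ((dphi s * phi s + phi s * dphi s) * E s + phi s * phi s * (E s * - (2 * L))).
  move=> sI.
  exact: (is_derive_mul (is_derive_mul (dp s sI) (dp s sI)) (dE s)).
have [s sI] := mean_value01 d3.
rewrite phi0 mul0r mul0r subr0 => Es.
have key : dphi s * phi s <= L * phi s ^+ 2.
  apply: le_trans (ler_norm _) _.
  have d1 : `|dphi s| <= L * `|phi s|.
    rewrite -(ler_pXn2r (n := 2))// ?nnegrE ?mulr_ge0// exprMn !real_normK ?num_real//.
    exact: le.
  rewrite normrM -(@real_normK _ (phi s)) ?num_real// expr2 mulrA.
  by rewrite ler_wpM2r.
have : phi 1 * phi 1 * E 1 <= 0.
  rewrite Es.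
  have -> : (dphi s * phi s + phi s * dphi s) * E s +
      phi s * phi s * (E s * - (2 * L)) =
      2 * E s * (dphi s * phi s - L * phi s ^+ 2) by ring.
  by rewrite mulr_ge0_le0 ?subr_le0// mulr_ge0// expR_ge0.
rewrite pmulr_lle0 ?expR_gt0// -expr2 => h; apply/eqP.
by rewrite -sqrf_eq0 eq_le h sqr_ge0.
Qed.

Lemma constant_of_gradient_bound (u : 'rV[R]_n -> R) (K u0 : R) x0 :
  Ck 1 Omega u -> 0 <= K -> Omega x0 -> u x0 = u0 ->
  (forall x, Omega x -> dot (grad u x) (grad u x) <= K * (u x - u0) ^+ 2) ->
  forall x, Omega x -> u x = u0.
Proof.
move=> Cu K0 Ox0 ux0 hK; apply: (connected_propagation cO (S := fun z => u z = u0) Ox0 ux0).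
  move=> x Ox ux; apply: filterS (near_segment oO Ox) => y seg.
  set w := y - x in seg.
  pose phi (t : R) := u (x + t *: w) - u0.
  have y1 : x + 1 *: w = y by rewrite scale1r /w addrC subrK.
  apply/eqP; rewrite -subr_eq0 -{1}y1 -/(phi 1); apply/eqP.
  apply: (@gronwall_zero phi (fun t => dot w (grad u (x + t *: w)))
    (Num.sqrt (dot w w * K))); first exact: sqrtr_ge0.
  - move=> t tI; have d := C1_is_derive_line oO Cu (seg t tI).
    have := is_deriveB d (is_derive_cst u0 t 1).
    by rewrite subr0.
  - move=> t tI; rewrite sqr_sqrtr ?mulr_ge0 ?dot_ge0//.
    apply: le_trans (cauchy_schwarz _ _) _; rewrite -mulrA.
    by rewrite ler_wpM2l ?dot_ge0// hK//; exact: seg.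
  - by rewrite /phi scale0r addr0 ux subrr.
move=> x Ox ux.
have ux' : u x - u0 != 0 by rewrite subr_eq0; apply/eqP.
have c : (fun y => u y - u0) @ x --> u x - u0.
  have cu : u @ x --> u x := Ck_continuous Cu Ox.
  exact: (cvgB cu (cvg_cst u0)).
have nz : \forall y \near x, u y - u0 != 0 by exact: (cvgr_neq0 _ c ux').
by apply: filterS nz => y /eqP h uy; apply: h; rewrite uy subrr.
Qed.

End unique_continuation.

Section flat_solutions.
Context (R : realType) (n : nat) (Omega : set 'rV[R]_n).
Hypothesis oO : open Omega.
Hypothesis cO : connected Omega.
Variable u : 'rV[R]_n -> R.
Hypothesis hu3 : Ck 3 Omega u.
Hypothesis gn0 : forall x, Omega x -> grad u x != 0.
Implicit Types (x y z w : 'rV[R]_n).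

Definition direction x : 'rV[R]_n :=
  (Num.sqrt (dot (grad u x) (grad u x)))^-1 *: grad u x.

Lemma grad_norm_gt0 x : Omega x -> 0 < Num.sqrt (dot (grad u x) (grad u x)).
Proof. by move=> Ox; rewrite sqrtr_gt0 dot_gt0 gn0. Qed.

Lemma direction_unit x : Omega x -> dot (direction x) (direction x) = 1.
Proof.
move=> Ox; rewrite dotZl dotZr mulrA -expr2 exprVn sqr_sqrtr ?dot_ge0//.
by rewrite mulVf// gt_eqF// dot_gt0 gn0.
Qed.

Lemma grad_direction x : Omega x ->
  grad u x = Num.sqrt (dot (grad u x) (grad u x)) *: direction x.
Proof.
by move=> Ox; rewrite scalerA divff ?scale1r// lt0r_neq0// grad_norm_gt0.
Qed.

(** With a Hessian of rank one along the gradient, only the length of the gradient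
    can vary. *)
Lemma direction_constant (mu : 'rV[R]_n -> R) :
  (forall x, Omega x -> hess u x = mu x *: rank1 (grad u x) (grad u x)) ->
  forall x y, Omega x -> Omega y -> direction y = direction x.
Proof.
move=> hH; apply: (locally_constant cO) => x Ox.
apply: filterS (near_segment oO Ox) => y seg.
set w := y - x in seg.
have y1 : x + 1 *: w = y by rewrite scale1r /w addrC subrK.
apply/rowP => i.
have d0 (t : R) : 0 <= t <= 1 ->
    is_derive t 1 (fun s : R => direction (x + s *: w) 0 i) 0.
  move=> tI; have Oz := seg t tI; set z := x + t *: w in Oz.
  have dg k := is_derive_partial oO hu3 k Oz.
  set q := dot (grad u z) (grad u z).
  have q0 : 0 < q by rewrite dot_gt0 gn0.
  have Hz k : (w *m hess u z) 0 k = mu z * dot w (grad u z) * grad u z 0 k.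
    by rewrite hH// -scalemxAr mulmx_rank1 !mxE mulrA.
  have dq : is_derive t 1
      (fun s : R => dot (grad u (x + s *: w)) (grad u (x + s *: w)))
      (2 * mu z * dot w (grad u z) * q).
    have -> : (fun s : R => dot (grad u (x + s *: w)) (grad u (x + s *: w))) =
      (fun s => \sum_k partial k u (x + s *: w) * partial k u (x + s *: w)).
      by apply/funext => s; apply: eq_bigr => k _; rewrite !mxE.
    have -> : 2 * mu z * dot w (grad u z) * q = \sum_k
        2 * mu z * dot w (grad u z) * (grad u z 0 k * grad u z 0 k).
      by rewrite -mulr_sumr.
    apply: is_derive_sumE => k.
    apply: (is_derive_eq (is_derive_mul (dg k) (dg k))).
    by rewrite -/z Hz [grad u z 0 k]mxE; ring.
  have ds : is_derive t 1 (Num.sqrt \o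
      (fun s : R => dot (grad u (x + s *: w)) (grad u (x + s *: w))))
      ((2 * Num.sqrt q)^-1 * (2 * mu z * dot w (grad u z) * q)).
    by apply: is_derive1_comp dq; exact: is_derive1_sqrt.
  have sq0 : Num.sqrt q != 0 by rewrite gt_eqF// sqrtr_gt0.
  have dv := @is_deriveV R (Num.sqrt \o
    (fun s : R => dot (grad u (x + s *: w)) (grad u (x + s *: w)))) t _ _ sq0 ds.
  have -> : (fun s : R => direction (x + s *: w) 0 i) = (fun s : R =>
     (Num.sqrt (dot (grad u (x + s *: w)) (grad u (x + s *: w))))^-1 *
     partial i u (x + s *: w)).
    by apply/funext => s; rewrite !mxE.
  apply: (is_derive_eq (is_derive_mul dv (dg i))).
  rewrite -/z Hz [_ *: _](erefl (_ * _)) /= -/z -/q [grad u z 0 i]mxE.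
  have qs : q = Num.sqrt q ^+ 2 by rewrite sqr_sqrtr// ltW.
  by rewrite [X in 2 * mu z * _ * X]qs; field.
have [s sI] := mean_value01 d0; rewrite y1 scale0r addr0 => /eqP.
by rewrite subr_eq0 => /eqP.
Qed.

End flat_solutions.

(** * Solutions with constant gradient direction *)

Section half_space_geometry.
Context (R : realType) (n : nat) (Omega : set 'rV[R]_n).
Hypothesis oO : open Omega.
Variables (u : 'rV[R]_n -> R) (a : 'rV[R]_n).
Hypothesis Cu : Ck 1 Omega u.
Hypothesis cu : {within closure Omega, continuous u}.
Hypothesis u_gt0 : forall x, Omega x -> 0 < u x.
Hypothesis u_bd0 : forall p, boundary Omega p -> u p = 0.
Hypothesis grad_a : forall x, Omega x ->
  exists2 c : R, 0 < c & grad u x = c *: a.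
Implicit Types (x y z w p : 'rV[R]_n).

Lemma solution_increasing x w (t : R) : 0 <= dot w a -> 0 <= t ->
  (forall s : R, 0 <= s <= t -> Omega (x + s *: w)) -> u x <= u (x + t *: w).
Proof.
move=> wa t0 seg.
have d (s : R) : s \in `]0, t[ ->
    is_derive s 1 (fun r : R => u (x + r *: w)) (dot w (grad u (x + s *: w))).
  rewrite in_itv/= => /andP[s0 st].
  by apply: (C1_is_derive_line oO Cu); apply: seg; rewrite !ltW.
have c : {within `[0, t], continuous (fun r : R => u (x + r *: w))}.
  apply: derivable_within_continuous => s; rewrite in_itv/= => st.
  by have [] := C1_is_derive_line oO Cu (seg s st).
have [s] := MVT_segment t0 d c.
rewrite in_itv/= => /seg Os; rewrite scale0r addr0 subr0 => E.
rewrite -subr_ge0 E mulr_ge0//; have [k k0 ->] := grad_a Os.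
by rewrite dotZr mulr_ge0// ltW.
Qed.

(** Along a ray of nonnegative slope [u] cannot decrease from its positive
    value at [x] to the value [0] it would have on leaving [Omega]. *)
Lemma ray_stays x w (t : R) : Omega x -> 0 <= dot w a -> 0 <= t ->
  Omega (x + t *: w).
Proof.
move=> Ox wa t0; apply: contrapT => nOt.
pose B := [set s : R | 0 <= s /\ ~ Omega (x + s *: w)].
have B0 : B !=set0 by exists t.
have lB : lbound B 0 by move=> s [].
have hB : has_inf B by split=> //; exists 0.
set T := inf B.
have T0 : 0 <= T by apply: lb_le_inf.
have below (s : R) : 0 <= s < T -> Omega (x + s *: w).
  move=> /andP[s0 sT]; apply: contrapT => nO.
  have : T <= s by apply: ge_inf; [exists 0|split].
  by rewrite leNgt sT.
have nOT : ~ Omega (x + T *: w).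
  move=> OT; have cl := @line_continuous R n x w T.
  have nO : \forall s \near T, Omega (x + s *: w).
    by apply: cl; exact: open_nbhs_nbhs.
  have /nbhs_ballP[r /= r0 hr] := nO.
  have [s [s0 ns] sT] := inf_adherent r0 hB.
  apply: (ns); apply: hr; rewrite /ball/= distrC ger0_norm.
    by rewrite ltrBlDl.
  by rewrite subr_ge0; apply: ge_inf; [exists 0|split].
have T_gt0 : 0 < T.
  rewrite lt_neqAle T0 andbT; apply/eqP => TE; apply: nOT.
  by rewrite -TE scale0r addr0.
set p := x + T *: w in nOT.
have line_near (A : set 'rV[R]_n) : nbhs p A -> exists2 s : R, 0 <= s < T &
    A (x + s *: w).
  move=> pA; have cl := @line_continuous R n x w T.
  have nA : \forall s \near T, A (x + s *: w) by exact: cl.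
  have /nbhs_ballP[r /= r0 hr] := nA.
  exists (Num.max 0 (T - r / 2)).
    by rewrite le_max lexx/= gt_max T_gt0 gtrBl divr_gt0.
  apply: hr; rewrite /ball/= ger0_norm.
    rewrite ltrBlDl -ltrBlDr lt_max ltrD2l ltrN2 orbC.
    by rewrite ltr_pdivrMr// ltr_pMr// ltr1n.
  by rewrite subr_ge0 ge_max T0 gerBl divr_ge0// ltW.
have cp : closure Omega p.
  by move=> A /line_near[s sT As]; exists (x + s *: w); split=> //; exact: below.
have bp : boundary Omega p by split=> // /interior_subset.
have /subspace_continuousP/(_ p cp) cup := cu.
have up : u p < u x by rewrite (u_bd0 bp) u_gt0.
have hn : \forall y \near p, closure Omega y -> u y < u x.
  exact: (cvgr_lt _ cup _ up).
have [s sT hs] := line_near _ hn.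
have := hs (subset_closure (below _ sT)); apply/negP; rewrite -leNgt.
move/andP: sT => [s0 sT].
apply: solution_increasing => // r /andP[r0 rs]; apply: below.
by rewrite r0 (le_lt_trans rs).
Qed.

(** [Omega] is stable under all translations of nonnegative slope, that is,
    under a closed half-space of vectors, and so it is determined by any one of
    its boundary points. *)
Lemma omega_half_space p : boundary Omega p -> Omega = half_space p a.
Proof.
move=> [cp nip]; have nOp : ~ Omega p.
  by move=> Op; apply: nip; exact: open_nbhs_nbhs.
have stay x y : Omega x -> 0 <= dot (y - x) a -> Omega y.
  by move=> Ox yx; have := ray_stays Ox yx ler01; rewrite scale1r addrC subrK.
apply/seteqP; split=> x.
  move=> Ox; rewrite /half_space/= ltNge; apply/negP => h; apply: nOp.
  by apply: stay Ox _; rewrite -opprB dotNl dotC oppr_ge0.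
rewrite /half_space/= => h.
have c : (fun y => dot a (x - y)) @ p --> dot a (x - p).
  have c1 : (fun y : 'rV[R]_n => y) @ p --> p by move=> A.
  have c2 : (fun y : 'rV[R]_n => x - y) @ p --> x - p.
    exact: (cvgB (cvg_cst x) c1).
  exact: (@dot_cvg R n _ (nbhs p) _ (fun=> a) (fun y => x - y) _ _
    (cvg_cst a) c2).
have hn : \forall y \near p, 0 < dot a (x - y) by exact: (cvgr_gt _ c _ h).
have [y Oy hy] := near_closure_meet cp hn.
by apply: stay Oy _; rewrite dotC ltW.
Qed.

(** Two points of [Omega] on a common hyperplane orthogonal to [a] are joined in
    both directions by segments of slope zero. *)
Lemma parallel_solution p : dot a a = 1 -> Omega = half_space p a ->
  parallel p a u.
Proof.
move=> aa hO; exists (fun s => u (p + s *: a)) => x hx.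
set y := p + dot a (x - p) *: a.
have Ox : Omega x by rewrite hO.
have axy : dot a (y - x) = 0.
  have -> : y - x = dot a (x - p) *: a - (x - p).
    by rewrite /y; apply/rowP => j; rewrite !mxE; ring.
  by move: (x - p) => d; rewrite dotDr dotZr dotNr aa mulr1 subrr.
have Oy : Omega y.
  rewrite hO /half_space/= /y addrAC subrr add0r dotZr aa mulr1; exact: hx.
have le_u z z' : Omega z -> dot a (z' - z) = 0 -> u z <= u z'.
  move=> Oz zz; have h0 : 0 <= dot (z' - z) a by rewrite dotC zz.
  have := solution_increasing h0 ler01 (x := z).
  rewrite scale1r [z + _]addrC subrK; apply=> s /andP[s0 _].
  exact: ray_stays.
apply/eqP; rewrite eq_le !le_u//.
by rewrite -opprB dotNr axy oppr0.
Qed.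

End half_space_geometry.

(** * Rigidity *)

Section degenerate_maximum.
Context (R : realType).
Variables (f f' F : R -> R) (C : R).
Hypothesis hf : forall t : R, is_derive t 1 f (f' t).
Hypothesis hFf : forall t : R, is_derive t 1 F (f t).
Hypothesis cf' : continuous f'.
Hypothesis hF0 : forall t : R, F t <= 0.

Lemma mean_value_between (g g' : R -> R) (a h : R) :
  (forall t : R, is_derive t 1 g (g' t)) ->
  exists2 s : R, 0 <= s <= 1 & g (a + h) - g a = g' (a + s * h) * h.
Proof.
move=> dg.
have d (s : R) : 0 <= s <= 1 ->
    is_derive s 1 (g \o (fun s => a + s * h)) (g' (a + s * h) * h).
  by move=> _; apply: is_derive1_comp; exact: is_derive_affine.
have [s sI] := mean_value01 d; rewrite /= mul1r mul0r addr0 => E.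
by exists s.
Qed.

(** A zero of [F] is a maximum, so [f] vanishes there, and [f] is Lipschitz. *)
Lemma nonpositive_primitive_quadratic (u0 : R) : 0 <= u0 <= C -> F u0 = 0 ->
  exists2 K : R, 0 <= K & forall t : R, 0 <= t <= C ->
    - F t <= K * (t - u0) ^+ 2.
Proof.
move=> /andP[u00 u0C] Fu0; have C0 := le_trans u00 u0C.
have fu0 : f u0 = 0.
  have h : is_derive u0 1 F 0.
    apply: (@derive1_at_max R F (u0 - 1) (u0 + 1) u0).
    - by rewrite lerD2l (le_trans _ ler01)// oppr_le0.
    - by move=> t _; have [] := hFf t.
    - by rewrite in_itv/= gtrBl ltr01 ltrDl ltr01.
    - by move=> t _; rewrite Fu0.
  have <- := @derive_val _ _ _ _ _ _ _ (hFf u0).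
  exact: (@derive_val _ _ _ _ _ _ _ h).
have cn : {within `[0, C], continuous (fun t : R => `|f' t|)}.
  by apply: continuous_subspaceT => t; apply: cvg_norm; exact: cf'.
have [c _ hc] := @EVT_max R (fun t => `|f' t|) 0 C C0 cn.
exists `|f' c| => // t /andP[t0 tC]; set h := t - u0.
have tE : t = u0 + h by rewrite /h addrC subrK.
have [s /andP[s0 s1] Es] := mean_value_between u0 h hFf.
have [r /andP[r0 r1] Er] := mean_value_between u0 (s * h) hf.
rewrite -tE Fu0 subr0 in Es; rewrite fu0 subr0 in Er.
have rs : 0 <= r * s <= 1 by rewrite mulr_ge0//= mulr_ile1.
have hin : `|f' (u0 + r * (s * h))| <= `|f' c|.
  apply: hc; rewrite in_itv/= mulrA /h.
  move: rs => /andP[]; move: (r * s) => k k0 k1.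
  have -> : u0 + k * (t - u0) = (1 - k) * u0 + k * t by ring.
  rewrite addr_ge0 ?mulr_ge0 ?subr_ge0//=.
  have -> : C = (1 - k) * C + k * C by ring.
  by rewrite lerD// ler_wpM2l// subr_ge0.
rewrite Es Er; apply: le_trans (ler_norm _) _.
rewrite normrN !normrM -(@real_normK _ h) ?num_real// expr2 !mulrA.
rewrite ler_wpM2r// ler_wpM2r//.
rewrite mulrA in hin; rewrite (ger0_norm s0) -[leRHS]mulr1.
exact: ler_pM.
Qed.

End degenerate_maximum.

Lemma gradient_from_slope (R : realType) (m q C A : R) : 0 < m ->
  m ^+ 2 * (1 + q) = 1 -> 0 <= q -> q <= C ^+ 2 -> 1 - m <= A ->
  q <= 2 * (1 + C ^+ 2) * A.
Proof.
move=> m0 mq q0 qC mA.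
have m1 : m <= 1.
  rewrite -(ler_pXn2r (n := 2))// ?nnegrE ?(ltW m0)// expr1n -mq.
  by rewrite ler_peMr ?sqr_ge0// lerDl.
have -> : q = (1 + q) * ((1 - m) * (1 + m)).
  transitivity ((1 + q) - m ^+ 2 * (1 + q)); last by ring.
  by rewrite mq; ring.
rewrite [2 * _]mulrC -mulrA; apply: ler_pM.
- by rewrite addr_ge0.
- by rewrite mulr_ge0 ?subr_ge0// addr_ge0// ltW.
- by rewrite lerD2l.
rewrite mulrC; apply: ler_pM; rewrite ?subr_ge0 ?addr_ge0 ?(ltW m0)//.
by rewrite -[2]/(1 + 1) lerD2l.
Qed.

Lemma one_sub_le_opp (R : realFieldType) (a m : R) : a - m <= -1 -> 1 - m <= - a.
Proof. by move=> h; lra. Qed.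

Section rigidity.
Context (R : realType) (n : nat) (Omega : set 'rV[R]_n).
Hypothesis oO : open Omega.
Hypothesis cO : connected Omega.
Variable u : 'rV[R]_n -> R.
Hypothesis hu3 : Ck 3 Omega u.
Variables (f f' F : R -> R).
Hypothesis hf : forall t : R, is_derive t 1 f (f' t).
Hypothesis cf' : continuous f'.
Hypothesis hFf : forall t : R, is_derive t 1 F (f t).
Hypothesis equ : forall x, Omega x -> mean_curvature_op u x + f (u x) = 0.
Variables (C M : R).
Hypothesis cu : {within closure Omega, continuous u}.
Hypothesis u_gt0 : forall x, Omega x -> 0 < u x.
Hypothesis u_bd0 : forall p, boundary Omega p -> u p = 0.
Hypothesis huC : forall x, Omega x -> u x <= C.
Hypothesis hgC : forall x, Omega x -> enorm (grad u x) <= C.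
Hypothesis hF0 : forall t : R, F t <= 0.
Hypothesis M_geN1 : -1 <= M.
Hypothesis P_le : forall x, Omega x -> P_function F u x <= M.
Variable p0 : 'rV[R]_n.
Hypothesis bp0 : boundary Omega p0.
Implicit Types (x y z w : 'rV[R]_n).

(** If the gradient vanished at a maximum, then [M = -1] and [F (u x) = 0].
    The bound [P <= -1] then controls the gradient by [|u - u x|], so [u] would
    be constant and positive, against the boundary condition. *)
Lemma gradient_neq0_of_max x : Omega x -> P_function F u x = M ->
  grad u x != 0.
Proof.
move=> Ox PxM; apply/eqP => g0.
have s1 : slope u x = 1 by rewrite /slope g0 dot0l /isqrt1 addr0 sqrtr1 invr1.
have [Fux MN1] : F (u x) = 0 /\ M = -1.
  move: PxM; rewrite P_functionE s1 => PxM.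
  have Fx : F (u x) = 0.
    by apply/eqP; rewrite eq_le hF0 -(lerD2r (-1)) PxM add0r.
  by split=> //; rewrite -PxM Fx sub0r.
have ux : 0 <= u x <= C by rewrite ltW ?u_gt0 ?huC.
have [K K0 hK] := nonpositive_primitive_quadratic hf hFf cf' hF0 ux Fux.
have bound y : Omega y ->
    dot (grad u y) (grad u y) <= 2 * (1 + C ^+ 2) * K * (u y - u x) ^+ 2.
  move=> Oy; rewrite -mulrA.
  apply: (gradient_from_slope (slope_gt0 u y) (slope_sqr u y) (dot_ge0 _)).
    exact: (grad_sqr_bound hgC Oy).
  have uy : 0 <= u y <= C by rewrite ltW ?u_gt0 ?huC.
  apply: le_trans (hK _ uy).
  by apply: one_sub_le_opp; rewrite -P_functionE -MN1; exact: P_le.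
have K1 : 0 <= 2 * (1 + C ^+ 2) * K.
  by rewrite !mulr_ge0// addr_ge0 ?sqr_ge0.
have cst := constant_of_gradient_bound oO cO (CkW (CkW hu3)) K1 Ox
  (erefl (u x)) bound.
have [cp _] := bp0.
have /subspace_continuousP/(_ p0 cp) cup := cu.
have up : u p0 < u x by rewrite (u_bd0 bp0) u_gt0.
have hn : \forall y \near p0, closure Omega y -> u y < u x.
  exact: (cvgr_lt _ cup _ up).
have [y Oy hy] := near_closure_meet cp hn.
by have := hy (subset_closure Oy); rewrite cst// ltxx.
Qed.

Lemma P_constant x0 : Omega x0 -> P_function F u x0 = M ->
  forall x, Omega x -> P_function F u x = M.
Proof.
move=> Ox0 Px0.
apply: (connected_propagation cO (S := fun x => P_function F u x = M) Ox0 Px0).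
  move=> x Ox Px.
  exact: (P_max_open oO hu3 hf hFf equ u_gt0 huC hgC P_le Ox
    (gradient_neq0_of_max Ox Px) Px).
move=> x Ox Px.
have Px' : P_function F u x < M by rewrite lt_neqAle (P_le Ox) andbT; exact/eqP.
have nl : \forall y \near x, P_function F u y < M.
  exact: (cvgr_lt _ (P_continuous hu3 hFf Ox) _ Px').
by apply: filterS nl => y yM yE; move: yM; rewrite yE ltxx.
Qed.

(** A constant [P] makes the Hessian a multiple of [g g^T] for [g] the gradient,
    so the direction of the gradient is constant. *)
Lemma half_space_of_constant_P x0 : Omega x0 ->
  (forall x, Omega x -> P_function F u x = M) ->
  exists a : 'rV[R]_n,
    [/\ a != 0, Omega = half_space p0 a & parallel p0 a u].
Proof.
move=> Ox0 PM.
have gn0 x : Omega x -> grad u x != 0.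
  by move=> Ox; apply: gradient_neq0_of_max => //; exact: PM.
have nO x : Omega x -> \forall y \near x, Omega y.
  by move=> Ox; exact: open_nbhs_nbhs.
have hH x : Omega x -> hess u x = (- f (u x) /
    (slope u x ^+ 3 * dot (grad u x) (grad u x))) *: rank1 (grad u x) (grad u x).
  move=> Ox; apply: (hess_of_constant_P oO hu3 hf hFf equ Ox (gn0 _ Ox)).
  by apply: filterS (nO x Ox) => y Oy; rewrite !PM.
have dc := direction_constant oO cO hu3 gn0 hH.
set a := direction u x0.
have aa : dot a a = 1 := direction_unit gn0 Ox0.
have grad_a x : Omega x -> exists2 c : R, 0 < c & grad u x = c *: a.
  move=> Ox; exists (Num.sqrt (dot (grad u x) (grad u x))).
    exact: (grad_norm_gt0 gn0).
  by rewrite /a (dc x x0 Ox Ox0); exact: (grad_direction gn0).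
have Cu := CkW (CkW hu3).
have hO := omega_half_space oO Cu cu u_gt0 u_bd0 grad_a bp0.
exists a; split=> //.
  by rewrite -dot_gt0 aa ltr01.
exact: (parallel_solution oO Cu cu u_gt0 u_bd0 grad_a aa hO).
Qed.

End rigidity.

Theorem theorem2p1 (R : realType) (n : nat) (hn : (2 <= n)%N)
    (Omega : set 'rV[R]_n) (hOmega : C1_domain Omega)
    (f : R -> R) (hf : Ck_real 1 f) (kappa : R)
    (u : 'rV[R]_n -> R) (hu3 : Ck 3 Omega u)
    (hu1 : C1_up_to_boundary Omega u)
    (hu : overdetermined_solution Omega f kappa u)
    (C : R) (huC : forall x, Omega x -> u x <= C)
    (hgC : forall x, Omega x -> enorm (grad u x) <= C)
    (F : R -> R) (hF2 : Ck_real 2 F)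
    (hFf : forall t : R, is_derive t 1 F (f t))
    (hF0 : forall t : R, F t <= 0) :
  let M : R := Num.max (-1) (F 0 - (Num.sqrt (1 + kappa ^+ 2))^-1) in
  (forall x, Omega x -> P_function F u x <= M) /\
  (boundary Omega !=set0 ->
   (exists2 x0, Omega x0 & P_function F u x0 = M) ->
   (exists c : R, forall x, Omega x -> P_function F u x = c) /\
   exists x0 a : 'rV[R]_n,
     [/\ a != 0, Omega = half_space x0 a & parallel x0 a u]).
Proof.
move=> M; have [oO _ cO charts] := hOmega.
have [Cu cu [G cG GE]] := hu1.
have [equ u_gt0 u_bd0 u_nu] := hu.
have [df cf'] := hf.
have hf' (t : R) : is_derive t 1 f (derive1n 1 f t).
  by have d := df 0%N isT t; rewrite derive1n1 derive1E; exact: derivableP d.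
have M_geN1 : -1 <= M by rewrite /M le_max lexx.
have bdM p : boundary Omega p -> F (u p) - isqrt1 (dot (G p) (G p)) <= M.
  move=> bp; have up := u_bd0 p bp.
  rewrite (boundary_gradient_norm oO Cu cu cG GE u_gt0 bp up (charts p bp)
    (fun nu => u_nu p nu bp)) up.
  by rewrite /M le_max lexx orbT.
have P_le := P_le_bound oO hu3 hf' hFf equ cu cG GE u_gt0 u_bd0 huC hgC hF0
  M_geN1 bdM.
split=> // -[p0 bp0] [x0 Ox0 Px0].
have PM := P_constant oO cO hu3 hf' cf' hFf equ cu u_gt0 u_bd0 huC hgC hF0
  M_geN1 P_le bp0 Ox0 Px0.
split; first by exists M.
exists p0; exact: (half_space_of_constant_P oO cO hu3 hf' cf' hFf equ cu u_gt0
  u_bd0 huC hgC hF0 M_geN1 P_le bp0 Ox0 PM).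
Qed.
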